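(* Let $K$ be a field of characteristic zero, let a domain $A=K\langle y_1,\ldots,y_r\rangle$ be an affine commutative $K$-algebra (generated by $y_1,\ldots,y_r$) of Krull dimension $s\ge1$, and let $\widetilde K$ be the algebraic closure of the field $K$ in the algebra $A$ ($\widetilde K$ is a field with $[\widetilde K:K]<\infty$). The following statements are equivalent. 1. There exist $s$ commuting locally nilpotent derivations $\delta_1,\ldots,\delta_s\in\mathrm{Der}_K(A)$ with generic kernels. 2. $A=\widetilde K[x_1,\ldots,x_s]$ is a polynomial algebra over the field $\widetilde K$ in $s$ variables. 3. There exist commuting locally nilpotent derivations $\delta_1,\ldots,\delta_s\in\mathrm{Der}_{\widetilde K}(A)$ and elements $x_1,\ldots,x_s\in A$ such that $\delta_i(x_j)=\delta_{ij}$ (the Kronecker delta) for all $1\le i,j\le s$. If the first statement holds, $\{N_i\}$ is the filtration on $A$ associated with the derivations $\delta_1,\ldots,\delta_s$, and $x_1,\ldots,x_s\in A$ are elements with $\delta_i(x_j)=\delta_{ij}$ for all $i,j$, then (i) $\dim_K(N_i)=[\widetilde K:K]\binom{i+s}{s}=\frac{[\widetilde K:K]}{s!}i^s+\cdots$ for all $i\ge0$. (ii) The map $\phi:A\to\widetilde K$ is an algebra epimorphism with kernel $(x_1,\ldots,x_s)$, i.e. $\widetilde K\simeq A/(x_1,\ldots,x_s)$. Alternatively, the field $\widetilde K$ is generated over $K$ by the elements $\phi(y_1),\ldots,\phi(y_r)$ that satisfy the defining relations $\mathcal R=\{f(t_1,\ldots,t_r)\in K[t_1,\ldots,t_r]\mid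 f(\phi(y_1),\ldots,\phi(y_r))\in(x_1,\ldots,x_s)\}$.
   Context: A derivation is locally nilpotent if each element is killed by some power of it. For derivations $\delta_1,\ldots,\delta_s$ of $A$: $A^{\delta_i}=\ker\delta_i$, $A^\delta=\bigcap_iA^{\delta_i}$, $A^\delta_{\widehat i}=\bigcap_{j\ne i}A^{\delta_j}$ (equal to $A$ if $s=1$). The derivations have generic kernels if $A^\delta\ne A^\delta_{\widehat i}$ for all $i=1,\ldots,s$ (for $s\ge2$ equivalently, the $2^s-1$ sets $\bigcap_{i\in I}A^{\delta_i}$, $\emptyset\ne I\subseteq\{1,\ldots,s\}$, are distinct). With $\delta^\alpha=\delta_1^{\alpha_1}\cdots\delta_s^{\alpha_s}$ and $|\alpha|=\alpha_1+\cdots+\alpha_s$, $N_i=\{a\in A\mid\delta^\alpha(a)=0\text{ for all }\alpha\in\mathbb N^s\text{ with }|\alpha|>i\}$. The map $\phi$ is $\phi=\phi_s\phi_{s-1}\cdots\phi_1$ (composition), $\phi_i(a)=\sum_{k\ge0}(-1)^k\frac{x_i^k}{k!}\delta_i^k(a)$. $(x_1,\ldots,x_s)$ is the ideal of $A$ generated by the $x_i$. That the generators satisfy the defining relations $\mathcal R$ means $\mathcal R$ is the kernel of the surjection $K[t_1,\ldots,t_r]\to\widetilde K$, $t_i\mapsto\phi(y_i)$. *)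

(* Defs.v *)
From HB Require Import structures.
From mathcomp Require Export all_boot all_order all_algebra mpoly.

Set Implicit Arguments.
Unset Strict Implicit.
Unset Printing Implicit Defensive.

Import GRing.Theory.
Local Open Scope ring_scope.

(* Subsets and ideals of A are Prop-valued predicates, so that they need not  *)
(* be decidable (ring_quotient.v only has boolean ideals).                    *)

Section KrullDimension.
Variable A : comNzRingType.

Definition is_ideal (P : A -> Prop) :=
  [/\ P 0, (forall a b, P a -> P b -> P (a + b))
    & (forall c a, P a -> P (c * a))].

Definition is_prime_ideal (P : A -> Prop) :=
  [/\ is_ideal P, ~ P 1 & (forall a b, P (a * b) -> P a \/ P b)].

Definition strict_subset (P Q : A -> Prop) :=
  (forall a, P a -> Q a) /\ (exists2 a, Q a & ~ P a).

Definition has_prime_chain (n : nat) :=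
  exists P : nat -> A -> Prop,
    (forall i, (i <= n)%N -> is_prime_ideal (P i)) /\
    (forall i, (i < n)%N -> strict_subset (P i) (P i.+1)).

Definition krull_dim_is (n : nat) :=
  has_prime_chain n /\ (forall m, has_prime_chain m -> (m <= n)%N).

Definition ideal_gen (s : nat) (x : 'I_s -> A) (a : A) :=
  exists c : 'I_s -> A, a = \sum_(i < s) c i * x i.

Definition is_subfield (B : A -> Prop) :=
  [/\ B 1, (forall a b, B a -> B b -> B (a - b)),
      (forall a b, B a -> B b -> B (a * b))
    & (forall a, B a -> a != 0 -> exists2 b, B b & a * b = 1)].

(* A = B[x_1, ..., x_s] is a polynomial algebra in x over the subring B:      *)
(* every element of A is the value at x of a unique polynomial over B.        *)
Definition is_polynomial_algebra (B : A -> Prop) (s : nat) (x : 'I_s -> A) :=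
  (forall a, exists2 p : {mpoly A[s]}, (forall m, B p@_m) & p.@[x] = a) /\
  (forall p q : {mpoly A[s]}, (forall m, B p@_m) -> (forall m, B q@_m) ->
     p.@[x] = q.@[x] -> p = q).

End KrullDimension.

Definition has_dim (K : fieldType) (V : lmodType K) (S : V -> Prop) (n : nat) :=
  exists b : 'I_n -> V,
    [/\ (forall i, S (b i)),
        (forall c : 'I_n -> K, \sum_(i < n) c i *: b i = 0 -> forall i, c i = 0)
      & (forall v, S v -> exists c : 'I_n -> K, v = \sum_(i < n) c i *: b i)].

Section Algebra.
Variables (K : fieldType) (A : comAlgType K).

Definition evalK (r : nat) (y : 'I_r -> A) (f : {mpoly K[r]}) : A :=
  mmap (in_alg A) y f.

Definition generates (r : nat) (y : 'I_r -> A) :=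
  forall a, exists f : {mpoly K[r]}, evalK y f = a.

(* mxpoly.algebraicOver is not applicable: it requires A to be a field.       *)
Definition alg_closure (a : A) :=
  exists2 p : {poly K}, p != 0 & root (map_poly (in_alg A) p) a.

Definition is_derivation (d : A -> A) :=
  linear d /\ (forall a b, d (a * b) = d a * b + a * d b).

Definition is_derivation_over (B : A -> Prop) (d : A -> A) :=
  is_derivation d /\ (forall c a, B c -> d (c * a) = c * d a).

Definition locally_nilpotent (d : A -> A) :=
  forall a, exists n, iter n d a == 0.

Section Family.
Variables (s : nat) (delta : 'I_s -> A -> A).

Definition commuting := forall i j a, delta i (delta j a) = delta j (delta i a).

Definition kernel (a : A) := forall i, delta i a = 0.
Definition kernel_hat (i : 'I_s) (a : A) := forall j, j != i -> delta j a = 0.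

Definition generic_kernels :=
  forall i, ~ (forall a, kernel a <-> kernel_hat i a).

Definition delta_pow (alpha : 'X_{1..s}) (a : A) : A :=
  foldr (fun j b => iter (alpha j) (delta j) b) a (enum 'I_s).

Definition filtration (i : nat) (a : A) :=
  forall alpha : 'X_{1..s}, (i < mdeg alpha)%N -> delta_pow alpha a = 0.

Definition kronecker (x : 'I_s -> A) :=
  forall i j, delta i (x j) = (i == j)%:R.

End Family.

(* phi_i(a) = \sum_(k >= 0) (-1)^k x^k / k! d^k(a): the terms vanish from the *)
(* least n such that d^n(a) = 0 onwards.                                      *)
Definition phi1 (d : A -> A) (nil_d : locally_nilpotent d) (x a : A) : A :=
  \sum_(k < ex_minn (nil_d a))
    ((-1) ^+ k * (k`!%:R)^-1 : K) *: (x ^+ k * iter k d a).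

(* phi_s \o ... \o phi_1, with phi_1 applied first.                           *)
Definition phi (s : nat) (delta : 'I_s -> A -> A)
    (nil_delta : forall i, locally_nilpotent (delta i))
    (x : 'I_s -> A) (a : A) : A :=
  foldl (fun b i => phi1 (nil_delta i) (x i) b) a (enum 'I_s).

End Algebra.

(* Main.v *)
Require Import Defs.
From HB Require Import structures.
From mathcomp Require Import all_boot all_order all_algebra mpoly ring.
From mathcomp Require Import generic_quotient.
From mathcomp Require boolp classical_sets.

Set Implicit Arguments.
Unset Strict Implicit.
Unset Printing Implicit Defensive.

Import GRing.Theory.
Local Open Scope ring_scope.

(** Generic kernels and local nilpotency give x'_j with c_j = delta_j(x'_j) a
    nonzero constant and delta_i(x'_j) = 0 for i <> j. Put c = prod c_j. If a
    nonzero constant b divided no power of c, an ideal Q containing b and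
    maximal among those avoiding the powers of c would be prime, with A/Q
    algebraic over K (Zariski's lemma). Passing from a prime to its largest
    delta_i-stable part keeps it prime in characteristic zero; doing this for
    i = s, ..., 1 starting from Q yields s + 1 primes, distinct because
    p(x'_j) separates consecutive ones when p is the minimal polynomial of x'_j
    modulo Q, and the smallest is nonzero as it contains b. Together with 0
    they form a chain of length s + 1 > dim A. So every nonzero constant divides
    a power of c, whence, reducing modulo an ideal maximal among those avoiding
    the powers of c, the constants are algebraic over K and form the field K~.
    The c_j are then invertible, so x_j = x'_j / c_j satisfies
    delta_i(x_j) = delta_ij, and Taylor expansion gives A = K~[x_1, ..., x_s]
    with delta_i = d/dx_i; on it phi is the constant coefficient and N_i
    consists of the polynomials of degree at most i. *)

(** * Maximal ideals avoiding the powers of an element *)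

(** Zorn's lemma on the ideals that contain [I] and no power of [c]. The last clause is the usable
    form of maximality: for [a] outside [Q], the ideal [Q + aA] contains a power of [c], so that [a]
    divides it modulo [Q]. *)
Lemma max_ideal_avoiding (A : comNzRingType) (c : A) (I : A -> Prop) :
  is_ideal I -> (forall n, ~ I (c ^+ n)) ->
  exists Q : A -> Prop,
    [/\ is_ideal Q, (forall a, I a -> Q a), (forall n, ~ Q (c ^+ n))
      & forall a, ~ Q a -> exists n u, Q (c ^+ n - a * u)].
Proof.
move=> idI Ic.
pose good (Q : A -> Prop) := [/\ is_ideal Q, (forall a, I a -> Q a)
  & forall n, ~ Q (c ^+ n)].
pose P (Q : A -> Prop) := (forall a, ~ Q a) \/ good Q.
have [F FP Ftot|Q [PQ Qmax]] := @classical_sets.Zorn_bigcup A P.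
  have [[S0 [FS0 [a0 S0a0]]]|noS] :=
      boolp.pselect (exists S, F S /\ exists a, S a); last first.
    left=> a [S FS Sa]; apply: noS; exists S; split=> //; by exists a.
  have nonemp S a : F S -> S a -> good S.
    by move=> FS Sa; case: (FP S FS) => // noa; case: (noa a).
  have [[S00 S0D S0M] S0I S0c] := nonemp _ _ FS0 S0a0.
  right; split; first split.
  - by exists S0.
  - move=> a b [S FS Sa] [T FT Tb].
    have [sST|sTS] := Ftot _ _ FS FT.
      have [[_ TD _] _ _] := nonemp _ _ FT Tb.
      by exists T => //; apply: TD => //; apply: sST.
    have [[_ SD _] _ _] := nonemp _ _ FS Sa.
    by exists S => //; apply: SD => //; apply: sTS.
  - move=> e a [S FS Sa]; exists S => //.
    by have [[_ _ SM] _ _] := nonemp _ _ FS Sa; apply: SM.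
  - by move=> a Ia; exists S0 => //; apply: S0I.
  - move=> n [S FS Sc]; have [_ _ /(_ n)] := nonemp _ _ FS Sc; exact.
have maxQ S : good S -> (forall a, Q a -> S a) -> forall a, S a -> Q a.
  move=> gS sQS a Sa; case: (boolp.pselect (Q a)) => // nQa.
  case: (Qmax S); last by right.
  by split=> [// | sSQ]; apply/nQa/sSQ.
case: PQ => [Q0|gQ].
  have gI : good I by [].
  have [I0 _ _] := idI.
  by case: (Q0 0); apply: (maxQ I gI _ _ I0) => a /Q0.
have [idQ QI Qc] := gQ; exists Q; split=> // a nQa.
case: (boolp.pselect (exists n u, Q (c ^+ n - a * u))) => // nex.
(* [S] is the ideal [Q + aA]; if it avoided all powers of [c], maximality would put [a] in [Q]. *)
pose S b := exists u, Q (b - a * u).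
have [Q0 QD QM] := idQ.
case: nQa; apply: (maxQ S); last by exists 1; rewrite mulr1 subrr.
  split; first split.
  - by exists 0; rewrite mulr0 subrr.
  - move=> b b' [u Qu] [u' Qu']; exists (u + u').
    by rewrite mulrDr opprD addrACA; apply: QD.
  - move=> e b [u Qu]; exists (e * u).
    by rewrite mulrCA -mulrBr; apply: QM.
  - by move=> b Ib; exists 0; rewrite mulr0 subr0; apply: QI.
  - by move=> n [u Qu]; apply: nex; exists n, u.
by move=> b Qb; exists 0; rewrite mulr0 subr0.
Qed.

(** If [a] and [b] divide [c ^+ n] and [c ^+ m] modulo [Q], then [a * b] divides [c ^+ (n + m)]
    modulo [Q], so [a * b] cannot lie in [Q]. *)
Lemma max_avoiding_prime (A : comNzRingType) (c : A) (Q : A -> Prop) :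
  is_ideal Q -> (forall n, ~ Q (c ^+ n)) ->
  (forall a, ~ Q a -> exists n u, Q (c ^+ n - a * u)) -> is_prime_ideal Q.
Proof.
move=> idQ Qc Qmax; have [Q0 QD QM] := idQ; split=> //; first exact: (Qc 0).
move=> a b Qab; case: (boolp.pselect (Q a)) => [|/Qmax[n [u Qu]]]; first by left.
case: (boolp.pselect (Q b)) => [|/Qmax[m [v Qv]]]; first by right.
case: (Qc (n + m)%N).
have -> : c ^+ (n + m) = c ^+ m * (c ^+ n - a * u)
    + (a * u * (c ^+ m - b * v) + (u * v) * (a * b)).
  by rewrite exprD; ring.
by apply: QD (QD _ _ _ _); apply: QM.
Qed.

(** Classical logic turns [Q] into a boolean predicate, to which the ring quotient construction
    applies. *)
Lemma quotient_domain (A : comNzRingType) (Q : A -> Prop) :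
  is_prime_ideal Q ->
  exists (D : comNzRingType) (pi : {rmorphism A -> D}),
    [/\ GRing.integral_domain_axiom D, (forall d, exists a, pi a = d)
      & forall a, pi a = 0 <-> Q a].
Proof.
move=> [[Q0 QD QM] Q1 Qprime].
pose S : {pred A} := fun a => boolp.asbool (Q a).
have SE a : reflect (Q a) (a \in S) by apply: boolp.asboolP.
have closedS : idealr_closed S.
  split; [exact/SE | exact/SE/Q1 |].
  by move=> a u v /SE Qu /SE Qv; apply/SE; apply: QD => //; apply: QM.
have primeS : prime_idealr_closed S.
  by move=> u v /SE /Qprime[] ?; apply/orP; [left | right]; apply/SE.
pose mI := isIdealr.Build A S closedS.
pose mP := isPrimeIdealrClosed.Build A S primeS.
pose I : prime_idealr A := HB.pack S mI mP.
exists {ideal_quot I}, (\pi_{ideal_quot I})%qT; split.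
- exact: Quotient.rquot_IdomainAxiom.
- by move=> d; exists (repr d); exact: reprK.
- move=> a.
  have : (a \in S) = ((\pi_{ideal_quot I})%qT a == (\pi_{ideal_quot I})%qT 0).
    by rewrite -{1}[a]subr0; exact: (@Quotient.idealrBE A I a 0).
  rewrite rmorph0 => E.
  by split => [/eqP | /SE Sa]; last apply/eqP; rewrite -E // => /SE.
Qed.

(** * Zariski's lemma *)

(** With [l] the leading coefficient and [n.+1] the degree of [p], multiplying [p(y) = 0] by
    [l ^+ n] gives a monic equation for [l * y], whose coefficients below the top are
    [p_i * l ^+ (n - i)]. *)
Lemma integral_lead_coef_mul (R D : comNzRingType) (iota : {rmorphism R -> D})
    (p : {poly R}) (y : D) :
  root (map_poly iota p) y -> integralOver iota (iota (lead_coef p) * y).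
Proof.
rewrite lead_coefE; case def_n: (size p).-1 => [|n] /rootP py0.
  have sp: (size p <= 1)%N by rewrite -subn1 in def_n; rewrite -subn_eq0 def_n.
  move: py0; rewrite [p]size1_polyC // map_polyC hornerC coefC /= => ->.
  by rewrite mul0r; apply: integral0.
set l := p`_n.+1; have sp : size p = n.+2 by case: (size p) def_n => // ? /= ->.
pose q := \poly_(i < n.+2) (if i == n.+1 then 1 else p`_i * l ^+ (n - i)).
have lcq : q`_n.+1 = 1 by rewrite coef_poly ltnSn eqxx.
have sq : size q = n.+2.
  apply/eqP; rewrite eqn_leq size_poly ltnNge; apply/negP => /leq_sizeP/(_ _ (leqnn _)).
  by rewrite lcq => /eqP; rewrite oner_eq0.
exists q; first by rewrite monicE lead_coefE sq lcq.
have szm (p' : {poly R}) : (size (map_poly iota p') <= size p')%N by apply: size_poly.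
apply/rootP; rewrite (@horner_coef_wide _ n.+2); last by rewrite -sq.
transitivity (iota l ^+ n * (map_poly iota p).[y]); last by rewrite py0 mulr0.
rewrite [in RHS](@horner_coef_wide _ n.+2) -?sp //.
rewrite sp mulr_sumr; apply: eq_bigr => i _; rewrite !coef_map coef_poly ltn_ord exprMn.
rewrite /=; case: eqP => [->|/eqP neq_i]; first by rewrite rmorph1 mul1r exprS; rewrite -/l; ring.
have le_in : (i <= n)%N by rewrite -ltnS ltn_neqAle neq_i -ltnS ltn_ord.
have -> : iota l ^+ n = iota l ^+ (n - i) * iota l ^+ i by rewrite -exprD subnK.
rewrite rmorphM rmorphXn /=; ring.
Qed.

Lemma integral_transfer (R R' D : nzRingType) (f : {rmorphism R -> R'})
    (iota : R -> D) (iota' : R' -> D) (u : D) :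
  (forall r, iota r = iota' (f r)) -> iota' 0 = 0 ->
  integralOver iota u -> integralOver iota' u.
Proof.
move=> eqi i0 [p mp pu]; exists (map_poly f p); first exact: monic_map.
rewrite -map_poly_comp_id0 //; congr (root _ u): pu.
by apply: eq_map_poly => r; rewrite eqi.
Qed.

(** A Noether normalization after inverting a single [a]: [R] is an iterated
    polynomial ring over [K]. The last clause says that either [R = K] or no
    localization of [R] at one element is a field. *)
Lemma generic_normalization (K : fieldType) (D : comNzRingType)
    (kappa : {rmorphism K -> D}) (ys : seq D) :
  GRing.integral_domain_axiom D ->
  exists (R : idomainType) (iota : {rmorphism R -> D}) (a : R),
    [/\ injective iota, a != 0, (forall k, exists r, iota r = kappa k),
        (forall y, y \in ys -> integralOver iota (iota a * y))
      & (forall r, exists k, iota r = kappa k) \/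
        (exists z : R, forall b u, b != 0 -> 1 + z * b != 0 /\ (1 + z * b) * u != 1)].
Proof.
move=> domD; elim: ys => [|y ys [R [iota [a [inj_iota a0 KR inta alt]]]]].
  exists K, kappa, 1; split=> //; [exact: fmorph_inj | exact: oner_neq0 | | ].
    by move=> k; exists k.
  by left=> r; exists r.
(* If [y] is algebraic over [R], the leading coefficient of its equation joins the denominator [a];
   otherwise [y] becomes a new variable. *)
have [[p p0 py]|transc] := boolp.pselect
    (exists2 p : {poly R}, p != 0 & root (map_poly iota p) y).
  exists R, iota, (a * lead_coef p); split=> //.
    by rewrite mulf_neq0 // lead_coef_eq0.
  move=> y'; rewrite inE => /orP[/eqP-> | ys_y']; rewrite rmorphM.
    by rewrite -mulrA; apply: integral_mul (integral_lead_coef_mul py); apply: integral_id.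
  by rewrite mulrAC; apply: integral_mul (integral_id _ _); apply: inta.
pose cy : commr_rmorph iota y := fun r => mulrC _ _.
pose iota' : {rmorphism {poly R} -> D} := horner_morph cy.
have iota'E q : iota' q = (map_poly iota q).[y] by [].
have iota'C r : iota' r%:P = iota r by rewrite iota'E map_polyC hornerC.
exists {poly R}, iota', a%:P; split.
- apply: raddf_inj => q q0; have [//|nq0] := eqVneq q 0.
  by case: transc; exists q => //; apply/rootP.
- by rewrite polyC_eq0.
- by move=> k; have [r <-] := KR k; exists r%:P.
- move=> y'; rewrite inE => /orP[/eqP-> | ys_y']; rewrite iota'C.
    have -> : iota a * y = iota' (a%:P * 'X).
      by rewrite rmorphM iota'C iota'E map_polyX hornerX.
    exact: integral_id.
  apply: (@integral_transfer _ _ _ polyC iota) (inta _ ys_y').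
    by move=> r; rewrite iota'C.
  exact: rmorph0.
(* For [b != 0] the polynomial [1 + 'X * b] has positive degree, so it is neither zero nor a unit
   over a domain. *)
- right; exists 'X => b u b0.
  have sz : (1 < size (1 + 'X * b)%R)%N.
    rewrite addrC size_polyDl mulrC size_mulX // ?size_poly1 //.
      by rewrite ltnS size_poly_gt0.
    by rewrite ltnS size_poly_gt0.
  have nz : 1 + 'X * b != 0 by rewrite -size_poly_gt0 (ltn_trans _ sz).
  split=> //; apply/eqP => /(congr1 (fun q : {poly R} => size q)); rewrite size_poly1 => e1.
  have u0 : u != 0 by apply: contra_eq_neq e1 => ->; rewrite mulr0 size_poly0.
  move: e1; rewrite size_mul //; move: sz; rewrite -[u != 0]size_poly_gt0 in u0.
  case: (size _) => [|[|m]] //= _; case: (size u) u0 => // k _.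
  by rewrite addnS.
Qed.

(** As [w != 0] in a domain, factors ['X] can be stripped from [p] until its constant term is
    nonzero; the equation then exhibits that term as a multiple of [w]. *)
Lemma algebraic_divides_const (R D : comNzRingType) (iota : {rmorphism R -> D})
    (p : {poly R}) (w : D) :
  GRing.integral_domain_axiom D -> w != 0 -> p != 0 -> root (map_poly iota p) w ->
  exists2 q, q != 0 & exists v, iota q = w * (map_poly iota v).[w].
Proof.
move=> domD w0; elim/poly_ind: p => [|p c IHp]; first by rewrite eqxx.
rewrite /root rmorphD rmorphM /= map_polyX map_polyC hornerMXaddC /= => nz /eqP pw.
have [c0|c0] := eqVneq c 0; last first.
  exists c => //; exists (- p); rewrite rmorphN hornerN.
  by apply/eqP; rewrite mulrN -addr_eq0 addrC mulrC pw.
apply: IHp; first by apply: contraNneq nz => ->; rewrite c0 mul0r addr0.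
by move/eqP: pw; rewrite c0 rmorph0 addr0 => /eqP /domD; rewrite (negPf w0) orbF.
Qed.

(** Multiplying the integral equation of [v], of degree [k], by [g ^+ k] turns it into one for
    [e = g * v] in which every term other than [e ^+ k] has a factor [g]. So divisibility in [D]
    descends to [R] up to a power. *)
Lemma integral_dvd_pow (R D : comNzRingType) (iota : {rmorphism R -> D})
    (g e : R) (v : D) :
  injective iota -> integralOver iota v -> iota g * v = iota e ->
  exists k h, e ^+ k = g * h.
Proof.
move=> inj_iota [p mp /rootP pv] gv; set k := (size p).-1.
have sp : size p = k.+1 by rewrite prednK // size_poly_gt0 monic_neq0.
exists k, (- \sum_(i < k) p`_i * e ^+ i * g ^+ (k - i.+1)).
apply: inj_iota; apply/eqP; rewrite mulrN rmorphN -addr_eq0; apply/eqP.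
transitivity (iota g ^+ k * (map_poly iota p).[v]); last by rewrite pv mulr0.
rewrite (@horner_coef_wide _ k.+1) -?sp ?size_poly // sp big_ord_recr /= mulrDr.
rewrite coef_map /= -lead_coefE (monicP mp) rmorph1 mul1r -exprMn gv addrC rmorphXn.
congr (_ + _); rewrite /= rmorphM rmorph_sum !mulr_sumr.
apply: eq_bigr => i _; rewrite coef_map /= !rmorphM !rmorphXn /= -gv exprMn.
have -> : iota g ^+ k = iota g ^+ i * (iota g * iota g ^+ (k - i.+1)).
  by rewrite -exprS -exprD subnSK // subnKC // ltnW.
ring.
Qed.

(** Modulo [g], the power [(g - 1) ^+ B] is [(-1) ^+ B], a unit. *)
Lemma unit_of_dvd_pow_pred (R : comNzRingType) (g t : R) B :
  (g - 1) ^+ B = g * t -> exists u, g * u = 1.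
Proof.
move=> gB; have := subrXX (-1) (g - 1) B; rewrite gB opprB addKr.
set S := \sum_(i < B) _ => /eqP; rewrite subr_eq mulNr addrC -mulrBr => /eqP E.
by exists ((-1) ^+ B * (t - S)); rewrite mulrCA -E -exprMn mulrNN mulr1 expr1n.
Qed.

(** Zariski's lemma for [D[1/c]]: the divisibility hypothesis says that this localization is a
    field. If the normalization [R] were larger than [K], an element [g] of [R] comaximal with a
    suitable denominator would have to be a unit. *)
Lemma integral_of_dvd_pow (K : fieldType) (D : comNzRingType)
    (kappa : {rmorphism K -> D}) (r : nat) (y : 'I_r -> D) (c : D) :
  GRing.integral_domain_axiom D -> (forall d, exists f, mmap kappa y f = d) ->
  c != 0 -> (forall d, d != 0 -> exists n u, c ^+ n = d * u) ->
  forall d, integralOver kappa d.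
Proof.
move=> domD genD c0 dvdc.
have [R [iota [a [inj_iota a0 KR inty alt]]]] :=
  generic_normalization kappa (codom y) domD.
(* Integrality over [R[1/a]], stated without building the localization. It holds on generators and
   is closed under ring operations, hence holds on all of [D]. *)
pose aint u := exists N, integralOver iota (iota a ^+ N * u).
have aint_iota b : aint (iota b) by exists 0; rewrite mul1r; apply: integral_id.
have aintD u v : aint u -> aint v -> aint (u + v).
  move=> [N intu] [M intv]; exists (N + M)%N.
  rewrite exprD mulrDr; apply: integral_add.
    by rewrite mulrAC mulrC; apply: integral_mul => //; rewrite -rmorphXn; apply: integral_id.
  by rewrite -mulrA; apply: integral_mul => //; rewrite -rmorphXn; apply: integral_id.
have aintM u v : aint u -> aint v -> aint (u * v).
  move=> [N intu] [M intv]; exists (N + M)%N.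
  by rewrite exprD mulrACA; apply: integral_mul.
have aint_kappa k : aint (kappa k) by have [b <-] := KR k.
have aint1 : aint 1 by rewrite -(rmorph1 iota).
have aint_all u : aint u.
  have [f <-] := genD u; rewrite /mmap; elim/big_ind: _ => //.
    by rewrite -(rmorph0 iota).
  move=> m _; apply: (aintM) => //; rewrite /mmap1; apply: (big_ind aint aint1 aintM) => i _.
  elim: (m i) => [|n IHn]; rewrite ?expr0 // exprS; apply: (aintM) => //.
  by exists 1%N; rewrite expr1; apply: inty; apply: codom_f.
(* When [R = K], the denominator [a] is a nonzero scalar and can be divided out. *)
case: alt => [RK d|[z zP]].
  have [k ak] := RK a; have [N [p mp pu]] := aint_all d.
  have k0 : k != 0 by apply: contraNneq a0 => k0; rewrite -(inj_eq inj_iota) ak k0 !rmorph0.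
  have -> : d = kappa (k ^- N) * (iota a ^+ N * d).
    rewrite ak mulrA -rmorphXn -rmorphM mulVf ?rmorph1 ?mul1r //.
    by rewrite expf_neq0.
  apply: integral_mul; first exact: integral_id.
  apply: integral_root_monic (monic_map iota mp) pu _.
  apply/integral_poly => i; rewrite coef_map /=.
  by have [k' ->] := RK p`_i; apply: integral_id.
have iota_eq0 b : (iota b == 0) = (b == 0) by rewrite -(inj_eq inj_iota) rmorph0.
have neq0M (u v : D) : u != 0 -> v != 0 -> u * v != 0.
  by move=> u0 v0; apply/eqP => /domD; rewrite (negPf u0) (negPf v0).
have neq0X (u : D) n : u != 0 -> u ^+ n != 0.
  move=> u0; elim: n => [|n IHn]; rewrite ?expr0 ?oner_eq0 // exprS; exact: neq0M.
(* The aim is a nonzero [q0] in [R] that becomes in [D] a multiple of [iota a ^+ N0 * c]. *)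
have [N0 [pc mpc pc0]] := aint_all c.
have [||q0 nz_q0 [v' q0E]] := algebraic_divides_const domD _ _ pc0.
- by apply: neq0M => //; apply: neq0X; rewrite iota_eq0.
- exact: monic_neq0.
set w' := _.[_] in q0E; pose g := 1 + z * (a * q0). (* comaximal with a * q0, yet it must divide a power of it *)
have [nzg _] := zP (a * q0) 1 (mulf_neq0 a0 nz_q0).
have [|n [u cn]] := dvdc (iota g); first by rewrite iota_eq0.
have [M intv] := aint_all (u * (iota a ^+ N0 * w') ^+ n).
(* Since [c ^+ n = iota g * u], the image of [q0 ^+ n] is a multiple of [iota g]; the factor
   [a ^+ M] makes the cofactor integral over [R]. *)
have [|k [h eh]] := @integral_dvd_pow _ _ _ g (a ^+ M * q0 ^+ n) _ inj_iota intv.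
  rewrite rmorphM !rmorphXn q0E mulrCA; congr (_ * _).
  by rewrite mulrA -cn -exprMn; congr (_ ^+ _); ring.
(* Large enough for [(g - 1) ^+ B = (z * (a * q0)) ^+ B] to be a multiple of
   [(a ^+ M * q0 ^+ n) ^+ k], hence of [g]. *)
pose B := maxn (M * k) (n * k).
have [|u' /eqP] := @unit_of_dvd_pow_pred _ g (z ^+ B * (a ^+ (B - M * k) * q0 ^+ (B - n * k) * h)) B.
  have -> : g - 1 = z * (a * q0) by rewrite /g addrC addKr.
  set X := a ^+ _; set Y := q0 ^+ _.
  have -> : g * (z ^+ B * (X * Y * h)) = z ^+ B * (X * Y * (g * h)) by ring.
  rewrite -eh !exprMn; congr (_ * _).
  rewrite -!exprM mulrACA -!exprD.
  by rewrite !subnK // ?leq_maxl ?leq_maxr.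
by have [_ /negPf->] := zP (a * q0) u' (mulf_neq0 a0 nz_q0).
Qed.

(** * The algebraic closure of K in A is finite-dimensional *)

Section Span.
Variables (K : fieldType) (D : comNzRingType) (kappa : {rmorphism K -> D}).

(** Scalars act through [kappa], so that residue rings of [A] need no algebra structure of their
    own; a finite index type allows products of families. *)
Definition spanned (T : finType) (b : T -> D) (d : D) :=
  exists c : T -> K, d = \sum_t kappa (c t) * b t.

Lemma spannedD (T : finType) (b : T -> D) d d' :
  spanned b d -> spanned b d' -> spanned b (d + d').
Proof.
move=> [c ->] [c' ->]; exists (fun t => c t + c' t); rewrite -big_split.
by apply: eq_bigr => t _; rewrite rmorphD mulrDl.
Qed.

Lemma spannedZ (T : finType) (b : T -> D) k d : spanned b d -> spanned b (kappa k * d).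
Proof.
move=> [c ->]; exists (fun t => k * c t); rewrite mulr_sumr.
by apply: eq_bigr => t _; rewrite rmorphM mulrA.
Qed.

Lemma spanned0 (T : finType) (b : T -> D) : spanned b 0.
Proof. by exists (fun=> 0); rewrite big1 // => t _; rewrite rmorph0 mul0r. Qed.

Lemma spanned_sum (T : finType) (b : T -> D) (I : Type) (s : seq I) (P : pred I) F :
  (forall i, spanned b (F i)) -> spanned b (\sum_(i <- s | P i) F i).
Proof.
move=> bF; apply: (big_ind (spanned b)) => //; first exact: spanned0.
by move=> *; apply: spannedD.
Qed.

Lemma spanned_gen (T : finType) (b : T -> D) t : spanned b (b t).
Proof.
exists (fun t' => (t' == t)%:R); rewrite (bigD1 t) //= eqxx rmorph1 mul1r.
by rewrite big1 ?addr0 // => t' /negPf->; rewrite rmorph0 mul0r.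
Qed.

(** Each new [y] replaces the family [b t] by the products [y ^+ i * b t] with [i] below the degree
    of a monic equation of [y], which rewrites the top power. *)
Lemma integral_fin_spanned (ys : seq D) :
  (forall y, y \in ys -> integralOver kappa y) ->
  exists (T : finType) (b : T -> D),
    spanned b 1 /\ forall y, y \in ys -> forall t, spanned b (y * b t).
Proof.
elim: ys => [|y ys IHys] inty.
  by exists unit, (fun=> 1); split=> //; apply: (spanned_gen _ tt).
have [|T [b [b1 bys]]] := IHys; first by move=> y' y'ys; apply: inty; rewrite inE y'ys orbT.
have [p mp /rootP py] : integralOver kappa y by apply: inty; rewrite inE eqxx.
set n := (size p).-1; have sp : size p = n.+1 by rewrite prednK // size_poly_gt0 monic_neq0.
have yn : y ^+ n = \sum_(i < n) kappa (- p`_i) * y ^+ i.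
  move: py; rewrite (@horner_coef_wide _ n.+1) -?sp ?size_poly //.
  rewrite sp big_ord_recr /= coef_map /= -/n -lead_coefE (monicP mp) rmorph1 mul1r.
  move/eqP; rewrite addrC addr_eq0 -sumrN => /eqP->.
  by apply: eq_bigr => i _; rewrite coef_map rmorphN mulNr.
have n0 : (0 < n)%N.
  rewrite lt0n; apply: contra_eq_neq yn => ->.
  by rewrite big_ord0 expr0 oner_neq0.
pose b' (u : 'I_n * T) := y ^+ u.1 * b u.2.
have spanM (i : 'I_n) d : spanned b d -> spanned b' (y ^+ i * d).
  move=> [c ->]; rewrite mulr_sumr; apply: spanned_sum => t.
  by rewrite mulrCA; apply: spannedZ; apply: (spanned_gen b' (i, t)).
exists ('I_n * T)%type, b'; split.
  by rewrite -[1](mul1r 1) -{1}(expr0 y); apply: (spanM (Ordinal n0)).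
move=> y'; rewrite inE => /orP[/eqP->|y'ys] [i t]; rewrite /b' /=; last first.
  by rewrite mulrCA; apply: spanM; apply: bys.
rewrite mulrA -exprS; have := ltn_ord i; rewrite leq_eqVlt => /orP[/eqP->|lt_in].
  rewrite yn mulr_suml; apply: spanned_sum => j; rewrite -mulrA; apply: spannedZ.
  exact: spanM (spanned_gen _ _).
exact: (spanM (Ordinal lt_in)) (spanned_gen _ _).
Qed.

(** A span that contains 1 and is stable under the generators contains every polynomial in them. *)
Lemma integral_fin_generated (r : nat) (y : 'I_r -> D) :
  (forall d, integralOver kappa d) -> (forall d, exists f, mmap kappa y f = d) ->
  exists (T : finType) (b : T -> D), forall d, spanned b d.
Proof.
move=> intD genD; have [|T [b [b1 by_]]] := @integral_fin_spanned (codom y).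
  by move=> *; apply: intD.
exists T, b => d; have [f <-] := genD d; apply: spanned_sum => m; apply: spannedZ.
rewrite -[mmap1 _ _]mulr1 /mmap1.
pose stable u := forall d, spanned b d -> spanned b (u * d).
suff : stable (\prod_(i < r) y i ^+ m i) by apply.
have stableM u v : stable u -> stable v -> stable (u * v).
  by move=> su sv d' bd'; rewrite -mulrA; apply/su/sv.
have stable1 : stable 1 by move=> d'; rewrite mul1r.
apply: (big_ind stable stable1 stableM) => i _.
elim: (m i) => [|n IHn]; rewrite ?expr0 // exprS; apply: (stableM) => // d' [c ->].
rewrite mulr_sumr; apply: spanned_sum => t; rewrite mulrCA; apply: spannedZ.
by apply: by_; apply: codom_f.
Qed.

(** The coordinate matrix has one more row than columns, so its left kernel is nonzero. *)
Lemma spanned_dependent (T : finType) (b : T -> D) (v : 'I_#|T|.+1 -> D) :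
  (forall i, spanned b (v i)) ->
  exists2 c : 'I_#|T|.+1 -> K, exists i, c i != 0 & \sum_i kappa (c i) * v i = 0.
Proof.
move=> /boolp.choice[c vE].
pose M := \matrix_(i < #|T|.+1, j < #|T|) c i (enum_val j).
have : kermx M != 0.
  by rewrite kermx_eq0 -row_leq_rank -ltnNge ltnS rank_leq_col.
case/rowV0Pn => u /sub_kermxP uM u0; exists (u 0).
  by case/rV0Pn: u0 => i ui; exists i.
under eq_bigr => i _ do rewrite vE mulr_sumr.
rewrite exchange_big big1 //= => t _.
under eq_bigr => i _ do rewrite mulrA -rmorphM.
rewrite -mulr_suml -rmorph_sum /=.
have := congr1 (fun N : 'rV_#|T| => N 0 (enum_rank t)) uM; rewrite !mxE => e.
rewrite [X in kappa X](_ : _ = 0) ?rmorph0 ?mul0r //.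
by rewrite -[RHS]e; apply: eq_bigr => i _; rewrite mxE enum_rankK.
Qed.

End Span.

(** An independent family of largest size inside [S] spans [S]: adding [v] creates a relation, and
    its coefficient at [v] is nonzero. *)
Lemma has_dim_of_bounded (K : fieldType) (V : lmodType K) (S : V -> Prop) (N : nat) :
  (forall v : 'I_N.+1 -> V, (forall i, S (v i)) ->
     exists2 c : 'I_N.+1 -> K, exists i, c i != 0 & \sum_i c i *: v i = 0) ->
  exists d, has_dim S d.
Proof.
move=> depN.
pose indep n (b : 'I_n -> V) := (forall i, S (b i)) /\
  forall c : 'I_n -> K, \sum_(i < n) c i *: b i = 0 -> forall i, c i = 0.
pose P n := boolp.asbool (exists b, @indep n b).
have exP : exists n, P n.
  exists 0%N; apply/boolp.asboolP; exists (fun=> 0); split=> [[]|? _ []] //.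
have boundP n : P n -> (n <= N)%N.
  move=> /boolp.asboolP[b [Sb indb]]; rewrite leqNgt; apply/negP => ltNn.
  have [|c [i ci] sum0] := depN (fun i => b (widen_ord ltNn i)); first by move=> j; apply: Sb.
  pose c' (j : 'I_n) := if insub (val j) is Some k then c k else 0.
  have c'E k : c' (widen_ord ltNn k) = c k by rewrite /c' /= valK.
  case/eqP: ci; rewrite -c'E; apply: indb; rewrite -[RHS]sum0.
  rewrite (bigID (fun j : 'I_n => (j < N.+1)%N)) /= [X in _ + X]big1 ?addr0; last first.
    by move=> j jN; rewrite /c' insubN ?scale0r.
  rewrite (big_ord_narrow ltNn).
  by apply: eq_bigr => j _; rewrite c'E.
case: (ex_maxnP exP boundP) => d /boolp.asboolP[b [Sb indb]] maxd.
exists d, b; split=> // v Sv.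
pose f (i : 'I_d.+1) := if unlift ord0 i is Some j then b j else v.
have f0 : f ord0 = v by rewrite /f unlift_none.
have fS i : f (lift ord0 i) = b i by rewrite /f liftK.
have [[c [c_nz sum0]]|nodep] := boolp.pselect (exists c : 'I_d.+1 -> K,
    (exists i, c i != 0) /\ \sum_i c i *: f i = 0).
  rewrite big_ord_recl f0 in sum0.
  have [c0|c0] := eqVneq (c ord0) 0.
    case: c_nz => i; rewrite c0 scale0r add0r in sum0.
    have cl j : c (lift ord0 j) = 0.
      apply: (indb (fun j => c (lift ord0 j))).
      by rewrite -[RHS]sum0; apply: eq_bigr => k _; rewrite fS.
    by case: (unliftP ord0 i) => [j|] ->; rewrite ?c0 ?cl eqxx.
  exists (fun i => - (c ord0)^-1 * c (lift ord0 i)).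
  move/eqP: sum0; rewrite addr_eq0 => /eqP/(congr1 (fun w => (c ord0)^-1 *: w)).
  rewrite scalerA mulVf // scale1r => ->; rewrite scalerN -scaleNr scaler_sumr.
  by apply: eq_bigr => i _; rewrite fS scalerA.
have /maxd : P d.+1; last by rewrite ltnn.
apply/boolp.asboolP; exists f; split=> [i|c sum0 i].
  by case: (unliftP ord0 i) => [j|] ->; rewrite ?f0 ?fS.
by have [//|ci] := eqVneq (c i) 0; case: nodep; exists c; split=> //; exists i.
Qed.

Section AlgClosure.
Variables (K : fieldType) (A : comAlgType K).
Hypothesis domA : GRing.integral_domain_axiom A.

Lemma alg_closureP (a : A) : alg_closure a <-> integralOver (in_alg A) a.
Proof.
split=> [[p p0 pa]|[p mp pa]]; last by exists p; rewrite ?monic_neq0.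
exists ((lead_coef p)^-1 *: p).
  by rewrite monicE lead_coefZ mulVf // lead_coef_eq0.
by rewrite /root map_polyZ hornerZ (rootP pa) mulr0.
Qed.

Lemma alg_closure_alg (k : K) : alg_closure (k%:A : A).
Proof. exact/alg_closureP/(integral_id (in_alg A)). Qed.

(** Algebraic elements are the integral ones, which form a ring. For inverses, a nonzero scalar [q]
    equals [a] times a polynomial in [a], and dividing by [q] inverts [a]. *)
Lemma alg_closure_subfield : is_subfield (alg_closure (A := A)).
Proof.
split.
- exact/alg_closureP/integral1.
- by move=> a b /alg_closureP ia /alg_closureP ib; apply/alg_closureP/integral_sub.
- by move=> a b /alg_closureP ia /alg_closureP ib; apply/alg_closureP/integral_mul.
move=> a [p p0 pa] a0.
have [q q0 [v qv]] := algebraic_divides_const domA a0 p0 pa.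
exists (q^-1 *: (map_poly (in_alg A) v).[a]).
  apply/alg_closureP; rewrite -mulr_algl; apply: integral_mul.
    exact: (integral_id (in_alg A)).
  apply: integral_horner; last by apply/alg_closureP; exists p.
  by apply/integral_poly => i; rewrite coef_map; apply: (integral_id (in_alg A)).
by rewrite -scalerAr -qv /= scalerA mulVf // scale1r.
Qed.

Lemma alg_closure0 : alg_closure (0 : A).
Proof. by rewrite -(scale0r 1); apply: alg_closure_alg. Qed.

Lemma alg_closureD (a b : A) : alg_closure a -> alg_closure b -> alg_closure (a + b).
Proof. by move=> /alg_closureP ia /alg_closureP ib; apply/alg_closureP/integral_add. Qed.

Lemma alg_closureM (a b : A) : alg_closure a -> alg_closure b -> alg_closure (a * b).
Proof. by move=> /alg_closureP ia /alg_closureP ib; apply/alg_closureP/integral_mul. Qed.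

Lemma alg_closureZ (k : K) (a : A) : alg_closure a -> alg_closure (k *: a).
Proof. by move=> ia; rewrite -mulr_algl; apply: alg_closureM => //; apply: alg_closure_alg. Qed.

Variables (r : nat) (y : 'I_r -> A).
Hypothesis genA : generates y.

(** Every nonzero element of [A/Q] divides a power of the image of [c], so Zariski's lemma applies
    to this domain and makes it finite over [K]. *)
Lemma max_avoiding_residue (c : A) (Q : A -> Prop) :
  is_ideal Q -> (forall n, ~ Q (c ^+ n)) ->
  (forall a, ~ Q a -> exists n u, Q (c ^+ n - a * u)) ->
  exists (D : comNzRingType) (pi : {rmorphism A -> D}),
    [/\ forall a, pi a = 0 <-> Q a,
        forall d, integralOver (pi \o in_alg A) d
      & exists (T : finType) (b : T -> D), forall d, spanned (pi \o in_alg A) b d].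
Proof.
move=> idQ Qc Qmax.
have [D [pi [domD pi_surj piQ]]] := quotient_domain (max_avoiding_prime idQ Qc Qmax).
have gen d : exists f, mmap (pi \o in_alg A) (pi \o y) f = d.
  have [a <-] := pi_surj d; have [f <-] := genA a; exists f.
  rewrite /evalK /mmap rmorph_sum; apply: eq_bigr => m _; rewrite rmorphM /mmap1.
  by rewrite rmorph_prod; congr (_ * _); apply: eq_bigr => i _; rewrite rmorphXn.
have intD d : integralOver (pi \o in_alg A) d.
  apply: (integral_of_dvd_pow (c := pi c) domD gen).
    by apply/eqP => /piQ; rewrite -[c]expr1; apply: Qc.
  move=> d'; have [a <-] := pi_surj d' => a0.
  have [|n [u Qu]] := Qmax a; first by move=> /piQ/eqP; apply/negP.
  exists n, (pi u); apply/eqP; rewrite -rmorphXn -rmorphM -subr_eq0 -rmorphB.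
  by apply/eqP/piQ.
exists D, pi; split=> //; exact: integral_fin_generated gen.
Qed.

(** For [c = 1] the ideal [Q] is maximal. Nonzero algebraic elements are units and so lie outside
    [Q]; the field of these elements therefore embeds in the finite-dimensional residue field. *)
Lemma alg_closure_fin_dim : exists d, has_dim (alg_closure (A := A)) d.
Proof.
have [//||Q [idQ _ Qc Qmax]] := @max_ideal_avoiding A 1 (fun a => a = 0).
- by split=> [// | a b -> -> | c a ->]; rewrite ?addr0 ?mulr0.
- by move=> n /eqP; rewrite expr1n oner_eq0.
have [D [pi [piQ _ [T [b bD]]]]] := max_avoiding_residue idQ Qc Qmax.
apply: (@has_dim_of_bounded _ _ _ #|T|) => v Kv.
have [c c_nz sum0] := spanned_dependent (fun i => bD (pi (v i))).
exists c => //; have [//|nz] := eqVneq (\sum_i c i *: v i) 0; case: (Qc 0%N); rewrite expr0.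
have [_ _ _ inv] := alg_closure_subfield.
have [|u _ <-] := inv _ _ nz.
  apply: (big_ind (alg_closure (A := A))); first exact: alg_closure0.
    by move=> *; apply: alg_closureD.
  by move=> i _; apply: alg_closureZ.
apply/piQ; rewrite rmorphM [pi (\sum_i _)](_ : _ = 0) ?mul0r // -[RHS]sum0.
by rewrite rmorph_sum; apply: eq_bigr => i _; rewrite /= -rmorphM mulr_algl.
Qed.

End AlgClosure.

(** * Derivations, prime ideals and the kernel *)

Section Derivation.
Variables (K : fieldType) (A : comAlgType K) (d : A -> A).
Hypothesis der_d : is_derivation d.

Lemma derD a b : d (a + b) = d a + d b.
Proof. by have [lin _] := der_d; have := lin 1 a b; rewrite !scale1r. Qed.

Lemma der0 : d 0 = 0.
Proof. by apply: (addrI (d 0)); rewrite -derD !addr0. Qed.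

Lemma derZ k a : d (k *: a) = k *: d a.
Proof. by have [lin _] := der_d; have := lin k a 0; rewrite der0 !addr0. Qed.

Lemma derM a b : d (a * b) = d a * b + a * d b.
Proof. by have [_] := der_d. Qed.

Lemma der_sum (I : Type) (s : seq I) (P : pred I) F :
  d (\sum_(i <- s | P i) F i) = \sum_(i <- s | P i) d (F i).
Proof. exact: (big_morph d derD der0). Qed.

Lemma der1 : d 1 = 0.
Proof. by apply: (addrI (d 1)); rewrite addr0 -[RHS](congr1 d (mulr1 1)) derM mulr1 mul1r. Qed.

Lemma derMn a n : d (a *+ n) = d a *+ n.
Proof. by rewrite -!scaler_nat derZ. Qed.

Lemma der_exp a n : d (a ^+ n) = (a ^+ n.-1 * d a) *+ n.
Proof.
elim: n => [|n IHn]; first by rewrite expr0 der1 mulr0n.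
rewrite exprS derM IHn mulrnAr mulrA; case: n {IHn} => [|n] /=.
  by rewrite expr0 mulr0n addr0 mulr1 mul1r.
by rewrite -exprS mulrC -mulrS.
Qed.

Lemma der_horner (p : {poly A}) a :
  (forall i, d p`_i = 0) -> d p.[a] = p^`().[a] * d a.
Proof.
elim/poly_ind: p => [|p c IHp] dp; first by rewrite deriv0 !horner0 mul0r der0.
rewrite hornerMXaddC derD derM IHp; last first.
  by move=> i; have := dp i.+1; rewrite coefD coefMX coefC addr0.
have -> : d c = 0 by have := dp 0%N; rewrite coefD coefMX coefC add0r.
rewrite derivD derivM derivX derivC !hornerE; ring.
Qed.

Lemma der_alg k : d k%:A = 0.
Proof. by rewrite derZ der1 scaler0. Qed.

Lemma der_horner_alg (p : {poly K}) a :
  d (map_poly (in_alg A) p).[a] = (map_poly (in_alg A) p^`()).[a] * d a.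
Proof. by rewrite der_horner ?deriv_map // => i; rewrite coef_map; apply: der_alg. Qed.

Lemma iter_der0 n : iter n d 0 = 0.
Proof. by elim: n => //= n ->; apply: der0. Qed.

Lemma iter_derD n a b : iter n d (a + b) = iter n d a + iter n d b.
Proof. by elim: n => //= n ->; apply: derD. Qed.

Lemma iter_derM n a b :
  iter n d (a * b) = \sum_(i < n.+1) (iter (n - i) d a * iter i d b) *+ 'C(n, i).
Proof.
elim: n => [|n IHn]; first by rewrite big_ord1 bin0.
rewrite iterS IHn der_sum.
under eq_bigr => i _ do rewrite derMn derM mulrnDl -!iterS -subSn ?(leq_ord i) //.
rewrite big_split /= [RHS]big_ord_recl [in LHS]big_ord_recl -addrA.
congr (_ + _); first by rewrite /= !bin0.
under [in RHS]eq_bigr => i _ do rewrite lift0 binS mulrnDr subSS.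
rewrite big_split /=; congr (_ + _).
rewrite [in RHS]big_ord_recr /= bin_small // mulr0n addr0.
by apply: eq_bigr => i _; rewrite /= /bump subSS.
Qed.

End Derivation.

(** * Prime ideals and constants in characteristic zero *)

Section CharZero.
Variables (K : fieldType) (A : comAlgType K).
Hypothesis char0 : [pchar K] =i pred0.

Lemma natK_neq0 n : n.+1%:R != 0 :> K.
Proof. by rewrite (proj1 (pcharf0P K) char0). Qed.

Lemma scale_natVK n (a : A) : (n.+1%:R)^-1 *: (a *+ n.+1) = a.
Proof. by rewrite -scaler_nat scalerA mulVf ?scale1r // natK_neq0. Qed.

Lemma ideal_sum (Q : A -> Prop) (I : Type) (s : seq I) (P : pred I) F :
  is_ideal Q -> (forall i, P i -> Q (F i)) -> Q (\sum_(i <- s | P i) F i).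
Proof. by move=> [Q0 QD _]; apply: big_ind. Qed.

Lemma idealZ (Q : A -> Prop) k a : is_ideal Q -> Q a -> Q (k *: a).
Proof. by move=> [_ _ QM] Qa; rewrite -mulr_algl; apply: QM. Qed.

Lemma idealMn (Q : A -> Prop) n a : is_ideal Q -> Q a -> Q (a *+ n).
Proof. by move=> idQ; rewrite -scaler_nat; apply: idealZ. Qed.

Lemma idealMr (Q : A -> Prop) a b : is_ideal Q -> Q a -> Q (a * b).
Proof. by move=> [_ _ QM] Qa; rewrite mulrC; apply: QM. Qed.

Lemma idealB (Q : A -> Prop) a b : is_ideal Q -> Q a -> Q b -> Q (a - b).
Proof. by move=> [_ QD QM] Qa Qb; rewrite -mulN1r; apply: QD => //; apply: QM. Qed.

Definition largest_stable (d : A -> A) (Q : A -> Prop) (a : A) := forall n, Q (iter n d a).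

(** Take the least [n] and [m] with [d^n a] and [d^m b] outside [Q]. In the Leibniz expansion of
    [d^(n+m) (a * b)] all terms but ['C(n + m, m)] times [d^n a * d^m b] lie in [Q], and the
    binomial is invertible in characteristic zero. *)
Lemma largest_stable_prime d Q :
  is_derivation d -> is_prime_ideal Q -> is_prime_ideal (largest_stable d Q).
Proof.
move=> der_d [idQ Q1 Qprime]; have [Q0 QD QM] := idQ; split.
- split.
  + by move=> n; rewrite iter_der0.
  + by move=> a b Qa Qb n; rewrite iter_derD //; apply: QD.
  + move=> c a Qa n; rewrite iter_derM //; apply: ideal_sum => // i _.
    by apply: idealMn => //; apply: QM.
- by move/(_ 0%N).
move=> a b Qab.
have first_not u : ~ largest_stable d Q u ->
    exists n, ~ Q (iter n d u) /\ forall m, (m < n)%N -> Q (iter m d u).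
  move=> nu; have exn : exists n, ~~ boolp.asbool (Q (iter n d u)).
    apply: boolp.contrapT => nex; apply: nu => n; apply: boolp.contrapT => nQ.
    by apply: nex; exists n; apply/boolp.asboolPn.
  case: (ex_minnP exn) => n /boolp.asboolPn nQ minn; exists n; split=> // m lt_mn.
  apply: boolp.contrapT => nQm.
  by have := minn m; rewrite leqNgt lt_mn => /(_ (introT (boolp.asboolPn _) nQm)).
apply: boolp.contrapT => /boolp.not_orP[/first_not[n [na mina]] /first_not[m [nb minb]]].
have := Qab (n + m)%N; rewrite iter_derM //.
have lt_m : (m < (n + m).+1)%N by rewrite ltnS leq_addl.
rewrite (bigD1 (Ordinal lt_m)) //= addnK => Qsum.
have Qrest : Q (\sum_(i < (n + m).+1 | i != Ordinal lt_m)
    (iter (n + m - i) d a * iter i d b) *+ 'C(n + m, i)).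
  apply: ideal_sum => // i /eqP neq_i; apply: idealMn => //.
  have [lt_im|] := ltnP i m; first by apply: QM; apply: minb.
  rewrite leq_eqVlt => /orP[/eqP e|lt_mi]; first by case: neq_i; apply/val_inj.
  apply: idealMr => //; apply: mina.
  by rewrite ltn_subLR ?(leq_ord i) // [(i + n)%N]addnC ltn_add2l.
have := idealB idQ Qsum Qrest; rewrite addrK.
have : (0 < 'C(n + m, m))%N by rewrite bin_gt0 leq_addl.
case: 'C(_, _) => // k _ /(idealZ (k.+1%:R)^-1 idQ); rewrite scale_natVK.
by case/Qprime.
Qed.

(** Replace [p] by its derivative as long as that also vanishes at [a] modulo [Q]. In characteristic
    zero the derivative of a nonconstant polynomial is nonzero, and no nonzero scalar lies in [Q],
    so the descent stops. *)
Lemma separable_mod_prime (Q : A -> Prop) (p : {poly K}) (a : A) :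
  is_prime_ideal Q -> p != 0 -> Q (map_poly (in_alg A) p).[a] ->
  exists2 q : {poly K}, Q (map_poly (in_alg A) q).[a]
    & ~ Q (map_poly (in_alg A) q^`()).[a].
Proof.
move=> [idQ Q1 Qprime]; elim: (size p) {-2}p (leqnn (size p)) => {p} [|n IHn] p.
  by rewrite size_poly_leq0 => /eqP->; rewrite eqxx.
move=> szp p0 Qp; have [Qp'|] := boolp.pselect (Q (map_poly (in_alg A) p^`()).[a]); last by exists p.
have [sz1|sz1] := leqP (size p) 1.
  case: Q1; move: p0 Qp; rewrite [p]size1_polyC // polyC_eq0 map_polyC hornerC /= => p0.
  by move/(idealZ (p`_0)^-1 idQ); rewrite scalerA mulVf // scale1r.
apply: IHn Qp'.
  rewrite -ltnS; apply: leq_trans szp; apply: lt_size_deriv.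
  by rewrite -size_poly_gt0 ltnW.
apply/eqP => /(congr1 (fun q : {poly K} => q`_(size p).-2)).
rewrite coef_deriv coef0 -mulr_natr => /eqP; rewrite mulf_eq0 (negPf (natK_neq0 _)) orbF.
rewrite prednK; last by rewrite -subn1 subn_gt0.
by rewrite -lead_coefE lead_coef_eq0 (negPf p0).
Qed.

Hypothesis domA : GRing.integral_domain_axiom A.

Lemma zero_prime : is_prime_ideal (fun a : A => a = 0).
Proof.
split; first by split=> [// | a b -> -> | c a ->]; rewrite ?addr0 ?mulr0.
  by apply/eqP/oner_neq0.
by move=> a b /domA/orP[] /eqP; [left | right].
Qed.

(** With [q(a) = 0] and [q'(a) != 0], applying [d] gives [q'(a) * d a = 0]. *)
Lemma der_alg_closure (d : A -> A) a : is_derivation d -> alg_closure a -> d a = 0.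
Proof.
move=> der_d [p p0 /rootP pa].
have [q qa q'a] := separable_mod_prime zero_prime p0 pa.
have := der_horner_alg der_d q a; rewrite qa der0 // => /esym/domA/orP[] /eqP //.
Qed.

Variables (s : nat) (delta : 'I_s -> A -> A).
Hypothesis der_delta : forall i, is_derivation (delta i).

(** Stable parts are taken successively; [f j] witnesses that the step for [delta j] is strict, and
    [b], killed by all derivations, survives in every stage and separates the smallest from 0. *)
Lemma prime_chain_of_derivations (Q : A -> Prop) (f : 'I_s -> A) (b : A) :
  is_prime_ideal Q ->
  (forall j, [/\ Q (f j), ~ Q (delta j (f j)) & forall i, i != j -> delta i (f j) = 0]) ->
  b != 0 -> Q b -> kernel delta b -> has_prime_chain A s.+1.
Proof.
move=> Qprime fP b0 Qb kerb.
pose stab l := foldr (fun i R => largest_stable (delta i) R) Q l.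
have stab_prime l : is_prime_ideal (stab l).
  by elim: l => //= i l IHl; apply: largest_stable_prime.
have stab_sub l a : stab l a -> Q a by elim: l => //= i l IHl /(_ 0%N).
have stab_ker l a : Q a -> (forall i, i \in l -> delta i a = 0) -> stab l a.
  elim: l => //= i l IHl Qa kera n.
  have sa : stab l a by apply: IHl => // j jl; apply: kera; rewrite inE jl orbT.
  case: n => // n; rewrite iterSr kera ?inE ?eqxx // iter_der0 //.
  by have [[]] := stab_prime l.
(* [L k] uses the derivations of index at least [k]: thus [L s] is [Q], and [L 0] to [L s] are
   [s + 1] primes, increasing with [k]. Putting 0 first yields [s + 2] primes. *)
pose L k := stab (drop k (enum 'I_s)).
have LE (j : 'I_s) : L j = largest_stable (delta j) (L j.+1).
  by rewrite /L (drop_nth j) ?size_enum_ord // nth_ord_enum.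
exists (fun k => if k is k'.+1 then L k' else (fun a => a = 0)); split.
  by move=> [_|k _]; [apply: zero_prime | apply: stab_prime].
move=> [_|k lt_ks].
  split=> [a ->|]; first by have [[]] := stab_prime (drop 0 (enum 'I_s)).
  by exists b; [apply: stab_ker => // i _; apply: kerb | apply/eqP].
pose j := Ordinal (lt_ks : (k < s)%N); rewrite -[k]/(val j); split.
  by move=> a; rewrite LE => /(_ 0%N).
(* [L j.+1] involves only indices above [j], whose derivations kill [f j], while [delta j (f j)] is
   outside [Q]. *)
have [Qf nQ df] := fP j; exists (f j); last first.
  by rewrite LE => /(_ 1%N) /stab_sub.
apply: stab_ker => // i /(nthP i)[m]; rewrite size_drop size_enum_ord => lt_m.
rewrite nth_drop => e; apply: df; apply: contra_eq_neq (congr1 val e) => ->.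
rewrite /= nth_enum_ord; last by rewrite -ltn_subRL.
by rewrite /= gtn_eqF // ltnS leq_addr.
Qed.

Variables (r : nat) (y : 'I_r -> A).
Hypothesis genA : generates y.
Hypothesis dimA : krull_dim_is A s.

(** The Krull dimension forces every nonzero constant to divide a power of the product [c] of the
    [delta j (x j)]; this makes constants algebraic. The converse is [der_alg_closure]. *)
Lemma kernel_eq_alg_closure (x : 'I_s -> A) :
  (forall j, delta j (x j) != 0) ->
  (forall i j, i != j -> delta i (x j) = 0) ->
  (forall j, kernel delta (delta j (x j))) ->
  forall b, kernel delta b <-> alg_closure b.
Proof.
move=> nz off ker b; split; last by move=> alg_b i; apply: der_alg_closure.
move=> kerb; pose c := \prod_j delta j (x j).
have c0 n : c ^+ n <> 0.
  have M0 (u v : A) : u != 0 -> v != 0 -> u * v != 0.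
    by move=> u0 v0; apply/eqP => /domA; rewrite (negPf u0) (negPf v0).
  apply/eqP; elim: n => [|n IHn]; rewrite ?expr0 ?oner_neq0 // exprS.
  by apply: (M0) IHn; apply: (big_ind (fun u => u != 0)); rewrite ?oner_neq0.
have kerM u v : kernel delta u -> kernel delta v -> kernel delta (u * v).
  by move=> ku kv i; rewrite derM // ku kv mul0r mulr0 addr0.
have dvd_c b' : b' != 0 -> kernel delta b' -> exists n u, c ^+ n = b' * u.
  move=> b'0 kerb'; apply: boolp.contrapT => nodvd.
  have [||Q [idQ QI Qc Qmax]] :=
      @max_ideal_avoiding A c (fun a => exists u, a = b' * u).
  - split; first by exists 0; rewrite mulr0.
      by move=> a1 a2 [u ->] [v ->]; exists (u + v); rewrite mulrDr.
    by move=> e a [u ->]; exists (e * u); rewrite mulrCA.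
  - by move=> n [u cn]; apply: nodvd; exists n, u.
  have Qprime := max_avoiding_prime idQ Qc Qmax.
  have [D [pi [piQ intD _]]] := max_avoiding_residue genA idQ Qc Qmax.
  have algQ j : exists2 q : {poly K}, Q (map_poly (in_alg A) q).[x j]
      & ~ Q (map_poly (in_alg A) q^`()).[x j].
    have [p mp /rootP pj] := intD (pi (x j)).
    apply: (separable_mod_prime Qprime (monic_neq0 mp)); apply/piQ.
    by rewrite -horner_map -map_poly_comp.
  have Qdelta j : ~ Q (delta j (x j)).
    move=> Qj; apply: (Qc 1%N); rewrite expr1 /c (bigD1 j) //=.
    exact: idealMr.
  have /boolp.choice[q qP] : forall j, exists q : {poly K},
      Q (map_poly (in_alg A) q).[x j] /\ ~ Q (map_poly (in_alg A) q^`()).[x j].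
    by move=> j; have [q ? ?] := algQ j; exists q.
  (* The separating elements are [q_j(x_j)]: their image under [delta j] is
     [q_j'(x_j) * delta j (x j)], a product of two elements outside the prime [Q]. *)
  have chain : has_prime_chain A s.+1.
    apply: (prime_chain_of_derivations Qprime
      (f := fun j => (map_poly (in_alg A) (q j)).[x j]) _ b'0) => //.
      move=> j; have [Qj nQj] := qP j; split=> //.
        by rewrite der_horner_alg //; have [_ _ QM] := Qprime => /QM[/nQj | /Qdelta].
      by move=> i /off xj; rewrite der_horner_alg // xj mulr0.
    by apply: QI; exists 1; rewrite mulr1.
  by have [_ /(_ _ chain)] := dimA; rewrite ltnn.
have [|//|Q [idQ QI Qc Qmax]] := @max_ideal_avoiding A c (fun a => a = 0).
  by have [] := zero_prime.
have [D [pi [piQ intD _]]] := max_avoiding_residue genA idQ Qc Qmax.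
(* [p(b)] is a constant lying in [Q]. Were it nonzero, it would divide a power of [c], which would
   then lie in [Q]. *)
have [p mp /rootP pb] := intD (pi b); exists p; first exact: monic_neq0.
apply/rootP; have [//|nz_pb] := eqVneq (map_poly (in_alg A) p).[b] 0.
have [|n [u cn]] := dvd_c _ nz_pb.
  by move=> i; rewrite der_horner_alg // kerb mulr0.
case: (Qc n); rewrite cn; apply: idealMr => //; apply/piQ.
by rewrite -horner_map -map_poly_comp.
Qed.

Lemma kronecker_kernel (x : 'I_s -> A) :
  kronecker delta x -> forall b, kernel delta b <-> alg_closure b.
Proof.
move=> krx; apply: (kernel_eq_alg_closure (x := x)).
- by move=> j; rewrite krx eqxx oner_neq0.
- by move=> i j /negPf; rewrite krx => ->.
- by move=> j i; rewrite krx eqxx der1.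
Qed.

Lemma generic_kernels_kronecker :
  commuting delta -> (forall i, locally_nilpotent (delta i)) ->
  generic_kernels delta -> exists x, kronecker delta x.
Proof.
move=> comm nil gen.
have iter_comm i j n a : delta i (iter n (delta j) a) = iter n (delta j) (delta i a).
  by elim: n => //= n <-.
have /boolp.choice[x xP] : forall j, exists xj,
    [/\ delta j xj != 0, delta j (delta j xj) = 0 & forall i, i != j -> delta i xj = 0].
  move=> j; have [a [hat_a ja]] : exists a, kernel_hat delta j a /\ delta j a != 0.
    apply: boolp.contrapT => nex; apply: (gen j) => a; split=> [ka i _|hat_a i]; first exact: ka.
    have [->|/hat_a//] := eqVneq i j.
    by have [//|ja] := eqVneq (delta j a) 0; case: nex; exists a.
  (* The least order of nilpotency at [a] is at least 2 because [delta j a != 0]; stopping two steps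
     before it gives an element whose image under [delta j] is nonzero and killed by [delta j]. *)
  case: (ex_minnP (nil j a)) => n /eqP na min_n.
  case: n na min_n => [a0|[ja0|n na min_n]].
  - by move: ja; rewrite [a]a0 der0 ?eqxx.
  - by move: ja; rewrite [delta j a]ja0 eqxx.
  exists (iter n (delta j) a); split=> //; last first.
    by move=> i ij; rewrite iter_comm hat_a ?iter_der0.
  by apply/negP => /(min_n n.+1); rewrite ltnn.
have kerE : forall b, kernel delta b <-> alg_closure b.
  apply: (kernel_eq_alg_closure (x := x)) => [j|i j ij|j i].
  - by have [] := xP j.
  - by have [_ _ ->] := xP j.
  have [_ jj off] := xP j; have [->//|ij] := eqVneq i j.
  by rewrite comm off // der0.
have [_ _ _ inv] := alg_closure_subfield domA.
have /boolp.choice[v vP] : forall j, exists v, alg_closure v /\ delta j (x j) * v = 1.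
  move=> j; have [nz jj off] := xP j.
  have [|v Kv e] := inv (delta j (x j)) _ nz; last by exists v.
  apply/kerE => i; have [->//|ij] := eqVneq i j.
  by rewrite comm off // der0.
(* Dividing by the invertible constant [delta j (x j)] normalizes the diagonal and keeps the other
   derivatives zero. *)
exists (fun j => x j * v j) => i j; have [/kerE kv e] := vP j.
rewrite derM // kv mulr0 addr0; have [->|ij] := eqVneq i j; first exact: e.
by have [_ _ ->] := xP j; rewrite ?mul0r.
Qed.

End CharZero.

(** * Dixmier maps and polynomial structure *)

Section AlgClosureCoef.
Variables (K : fieldType) (A : comAlgType K) (s : nat).
Implicit Types p q : {mpoly A[s]}.

(** A predicate on polynomials over [A], matching the coefficient condition of
    [is_polynomial_algebra]. *)
Definition algcoef p := forall m, alg_closure p@_m.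

Lemma alg_closureN (a : A) : alg_closure a -> alg_closure (- a).
Proof. by move=> Ka; rewrite -scaleN1r; apply: alg_closureZ. Qed.

Lemma alg_closure_nat n : alg_closure (n%:R : A).
Proof. by rewrite -scaler_nat; apply: alg_closure_alg. Qed.

Lemma alg_closureMn (a : A) n : alg_closure a -> alg_closure (a *+ n).
Proof. by move=> Ka; rewrite -scaler_nat; apply: alg_closureZ. Qed.

Lemma alg_closure_sum (I : Type) (r : seq I) (P : pred I) (F : I -> A) :
  (forall i, alg_closure (F i)) -> alg_closure (\sum_(i <- r | P i) F i).
Proof.
move=> KF; apply: (big_ind (alg_closure (A := A))) => //; first exact: alg_closure0.
by move=> *; apply: alg_closureD.
Qed.

Lemma algcoefD p q : algcoef p -> algcoef q -> algcoef (p + q).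
Proof. by move=> Kp Kq m; rewrite mcoeffD; apply: alg_closureD. Qed.

Lemma algcoefN p : algcoef p -> algcoef (- p).
Proof. by move=> Kp m; rewrite mcoeffN; apply: alg_closureN. Qed.

Lemma algcoefB p q : algcoef p -> algcoef q -> algcoef (p - q).
Proof. by move=> Kp Kq; apply/algcoefD/algcoefN. Qed.

Lemma algcoefM p q : algcoef p -> algcoef q -> algcoef (p * q).
Proof.
by move=> Kp Kq m; rewrite mcoeffM; apply: alg_closure_sum => k; apply: alg_closureM.
Qed.

Lemma algcoefC a : alg_closure a -> algcoef a%:MP.
Proof. by move=> Ka m; rewrite mcoeffC; apply/alg_closureM/alg_closure_nat. Qed.

Lemma algcoefX m : algcoef 'X_[m].
Proof. by move=> k; rewrite mcoeffX; apply: alg_closure_nat. Qed.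

Lemma algcoefZ a p : alg_closure a -> algcoef p -> algcoef (a *: p).
Proof. by move=> Ka Kp; rewrite -mul_mpolyC; apply/algcoefM/Kp/algcoefC. Qed.

Lemma algcoef_mderiv i p : algcoef p -> algcoef p^`M(i).
Proof. by move=> Kp m; rewrite mcoeff_mderiv; apply: alg_closureMn. Qed.

Lemma algcoef_sum (I : Type) (r : seq I) (P : pred I) (F : I -> {mpoly A[s]}) :
  (forall i, algcoef (F i)) -> algcoef (\sum_(i <- r | P i) F i).
Proof.
move=> KF; apply: (big_ind algcoef) => //; last by move=> *; apply: algcoefD.
by move=> m; rewrite mcoeff0; apply: alg_closure0.
Qed.

End AlgClosureCoef.

(** * Expansion in powers of an element with derivative one *)

Section DixmierExpansion.
Variables (K : fieldType) (A : comAlgType K) (d : A -> A) (x : A).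
Hypotheses (char0 : [pchar K] =i pred0) (der_d : is_derivation d) (dx : d x = 1).

Lemma natKI n (a : A) : a *+ n.+1 = 0 -> a = 0.
Proof. by move=> an; rewrite -(scale_natVK char0 n a) an scaler0. Qed.

Lemma fact_unit n : (n`!%:R : K) != 0.
Proof. by case: n`! (fact_gt0 n) => // k _; apply: natK_neq0. Qed.

Lemma iter_derZ n k a : iter n d (k *: a) = k *: iter n d a.
Proof. by elim: n => //= n ->; rewrite derZ. Qed.

Lemma iter_derMl n e a : d e = 0 -> iter n d (e * a) = e * iter n d a.
Proof. by move=> de; elim: n => //= n ->; rewrite derM // de mul0r add0r. Qed.

Lemma iter_der_exp n : iter n d (x ^+ n) = n`!%:R.
Proof.
elim: n => [|n IHn]; first by rewrite expr0.
rewrite iterSr der_exp // dx mulr1 -scaler_nat iter_derZ IHn.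
by rewrite scaler_nat -mulrnA mulnC -factS.
Qed.

(** With [e = d^n a / n!], subtracting [e * x ^+ n] from an element killed by [d^(n+1)] leaves one
    killed by [d^n]. The subspace [S] keeps track of where the coefficients lie; it will be a common
    kernel of other derivations. *)
Lemma dixmier_expansion (S : A -> Prop) (a : A) n :
  S 0 -> (forall u v, S u -> S v -> S (u - v)) -> (forall k u, S u -> S (k *: u)) ->
  (forall u, S u -> S (d u)) -> (forall u, S u -> S (x * u)) ->
  S a -> iter n d a = 0 ->
  exists2 p : {poly A}, forall i, S p`_i /\ d p`_i = 0 & p.[x] = a.
Proof.
move=> S0 SB SZ Sd Sx; elim: n a => [|n IHn] a Sa an.
  exists 0; last by rewrite horner0; exact: esym an.
  by move=> i; rewrite coef0 der0.
pose e := (n`!%:R : K)^-1 *: iter n d a.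
have de : d e = 0 by rewrite /e derZ // -iterS an scaler0.
have Se : S e by apply: (SZ); elim: n {an IHn e de} => //= n; apply: Sd.
have Sex : S (e * x ^+ n).
  rewrite mulrC; elim: {an IHn} n e {de} Se => [|n IHn] e Se; first by rewrite mul1r.
  by rewrite exprS -mulrA; apply/Sx/IHn.
have [||p pP pa] := IHn (a - e * x ^+ n); first exact: SB.
  rewrite -mulN1r mulrCA iter_derD // iter_derMl // mulN1r -scaleN1r iter_derZ.
  rewrite iter_der_exp scaleN1r mulrN /e -scalerAl -[X in _ *: X]mulrC mulr_natl.
  by rewrite -scaler_nat scalerA mulVf ?scale1r ?subrr // fact_unit.
exists (p + e%:P * 'X^n); last by rewrite !hornerE pa subrK.
move=> i; rewrite coefD coefCM coefXn; have [Sp dp] := pP i.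
split; last by rewrite derD // dp add0r mulr_natr derMn // de mul0rn.
have -> : p`_i + e * (i == n)%:R = p`_i - - e *+ (i == n).
  by rewrite mulr_natr mulNrn opprK.
apply: (SB) => //; case: (i == n); rewrite ?mulr0n // mulr1n -scaleN1r; exact: SZ.
Qed.

Hypothesis nil_d : locally_nilpotent d.

Lemma ker_expansion a : exists2 p : {poly A}, forall i, d p`_i = 0 & p.[x] = a.
Proof.
have [n /eqP an] := nil_d a.
have [|||||p pP pa] := @dixmier_expansion (fun=> True) a n I _ _ _ _ _ an => //.
by exists p => // i; have [] := pP i.
Qed.

Lemma iter_der_horner n (p : {poly A}) :
  (forall i, d p`_i = 0) -> iter n d p.[x] = p^`(n).[x].
Proof.
move=> dp; have dpn m i : d (p^`(m))`_i = 0 by rewrite coef_derivn derMn // dp mul0rn.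
elim: n => [//|n IHn].
by rewrite iterS IHn der_horner // dx mulr1 derivnS.
Qed.

Lemma phi1E a n : iter n d a = 0 ->
  phi1 nil_d x a =
    \sum_(k < n) ((-1) ^+ k * (k`!%:R)^-1 : K) *: (x ^+ k * iter k d a).
Proof.
move=> an; rewrite /phi1; case: ex_minnP => m /eqP am min_m.
have le_mn : (m <= n)%N by apply/min_m/eqP.
rewrite (big_ord_widen n (fun k => ((-1) ^+ k * (k`!%:R)^-1 : K) *: (x ^+ k * iter k d a)) le_mn).
rewrite [RHS](bigID (fun k : 'I_n => (k < m)%N)) /= [X in _ = _ + X]big1 ?addr0 // => k.
rewrite -leqNgt => le_mk; rewrite -(subnK le_mk) iterD am iter_der0 // mulr0 scaler0.
by [].
Qed.

(** With [d] acting on [p.[x]] as the formal derivative, the defining sum is the Taylor expansion of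
    [p] about [x] with increment [- x], so it equals [p.[0]]. The algebraic properties of [phi1] are
    read off from this. *)
Lemma phi1_horner (p : {poly A}) :
  (forall i, d p`_i = 0) -> phi1 nil_d x p.[x] = p`_0.
Proof.
move=> dp; rewrite (@phi1E _ (size p)); last first.
  by rewrite iter_der_horner // derivn_poly0 // horner0.
rewrite -horner_coef0 -[0 in RHS](subrr x) nderiv_taylor; last by rewrite /GRing.comm mulrC.
apply: eq_bigr => k _; rewrite iter_der_horner // nderivn_def hornerMn.
rewrite mulrnAr -(scaler_nat k`! (_ * _)) scalerA -mulrA mulVf ?fact_unit // mulr1.
rewrite [(- x) ^+ _]exprNn -[in LHS]signr_odd -[in RHS]signr_odd scaler_sign.
by case: (odd k); rewrite ?expr0 ?expr1; ring.
Qed.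

Lemma phi1_ker a : d a = 0 -> phi1 nil_d x a = a.
Proof.
move=> da; rewrite -{1}[a](hornerC a x) phi1_horner ?coefC // => i.
by rewrite coefC; case: eqP; rewrite ?da ?der0.
Qed.

Lemma phi1_x : phi1 nil_d x x = 0.
Proof.
rewrite -{2}[x](hornerX x) phi1_horner ?coefX // => i.
by rewrite coefX; case: eqP; rewrite ?der1 ?der0.
Qed.

Lemma phi1Z k a : phi1 nil_d x (k *: a) = k *: phi1 nil_d x a.
Proof.
have [p dp <-] := ker_expansion a.
rewrite -mulr_algl -hornerZ !phi1_horner ?coefZ ?mulr_algl // => i.
by rewrite coefZ mulr_algl derZ // dp scaler0.
Qed.

Lemma phi1D a b : phi1 nil_d x (a + b) = phi1 nil_d x a + phi1 nil_d x b.
Proof.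
have [p dp <-] := ker_expansion a; have [q dq <-] := ker_expansion b.
rewrite -hornerD !phi1_horner ?coefD // => i.
by rewrite coefD derD // dp dq addr0.
Qed.

Lemma phi1M a b : phi1 nil_d x (a * b) = phi1 nil_d x a * phi1 nil_d x b.
Proof.
have [p dp <-] := ker_expansion a; have [q dq <-] := ker_expansion b.
rewrite -hornerM !phi1_horner ?coef0M // => i.
rewrite coefM der_sum // big1 // => j _.
by rewrite derM // dp dq mul0r mulr0 addr0.
Qed.

End DixmierExpansion.

(** * The ideal generated by the variables *)

Section IdealGen.
Variables (A : comNzRingType) (s : nat) (x : 'I_s -> A).

Lemma ideal_gen_ideal : is_ideal (ideal_gen x).
Proof.
split; first by exists (fun=> 0); rewrite big1 // => i _; rewrite mul0r.
  move=> a b [c ->] [e ->]; exists (fun i => c i + e i); rewrite -big_split.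
  by apply: eq_bigr => i _; rewrite mulrDl.
move=> a b [c ->]; exists (fun i => a * c i); rewrite mulr_sumr.
by apply: eq_bigr => i _; rewrite mulrA.
Qed.

Lemma ideal_gen_var i : ideal_gen x (x i).
Proof.
exists (fun j => (j == i)%:R); rewrite (bigD1 i) //= eqxx mul1r big1 ?addr0 // => j.
by move/negPf->; rewrite mul0r.
Qed.

(** Every monomial other than 1 contains some [x i]. *)
Lemma meval_sub_const (p : {mpoly A[s]}) : ideal_gen x (p.@[x] - p@_0).
Proof.
have [I0 ID IM] := ideal_gen_ideal.
elim/mpolyind: p => [|c m p _ _ IHp]; first by rewrite meval0 mcoeff0 subrr.
rewrite mevalD mcoeffD opprD addrACA; apply: ID => //.
rewrite mevalZ mcoeffZ -mulrBr; apply: (IM); rewrite mcoeffX mevalX.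
have [->|/eqP m0] := eqVneq m 0%MM.
  by rewrite big1 ?subrr // => i _; rewrite mnm0E.
rewrite subr0; have [i mi] : exists i, m i != 0%N.
  apply/existsP; apply: contra_notT m0; rewrite negb_exists => /forallP m0.
  by apply/mnmP => i; rewrite mnm0E; apply/eqP; have := m0 i; rewrite negbK.
rewrite (bigD1 i) //= mulrC; apply: (IM).
by case: (m i) mi => // n _; rewrite exprSr; apply/IM/ideal_gen_var.
Qed.

End IdealGen.

Lemma mderiv_var (R : nzRingType) (s : nat) (i j : 'I_s) :
  ('X_j : {mpoly R[s]})^`M(i) = (i == j)%:R.
Proof.
rewrite mderivX mnm1E eq_sym; have [->|_] := eqVneq i j; last by rewrite scale0r.
rewrite scale1r (_ : (_ - _)%MM = 0%MM) ?mpolyX0 //.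
by apply/mnmP => k; rewrite mnmBE subnn mnm0E.
Qed.

(** * Polynomial structure and the map [phi] for a Kronecker family *)

Section KroneckerPolynomial.
Variables (K : fieldType) (A : comAlgType K) (s : nat).
Variables (delta : 'I_s -> A -> A) (x : 'I_s -> A).
Hypotheses (char0 : [pchar K] =i pred0) (der_delta : forall i, is_derivation (delta i)).
Hypotheses (kerE : forall b, kernel delta b <-> alg_closure b) (krx : kronecker delta x).

Lemma der_meval i (p : {mpoly A[s]}) :
  algcoef p -> delta i p.@[x] = p^`M(i).@[x].
Proof.
pose good (q : {mpoly A[s]}) := delta i q.@[x] = q^`M(i).@[x].
have good1 : good 1 by rewrite /good mevalC der1 // mderivC meval0.
have goodM q q' : good q -> good q' -> good (q * q').
  by rewrite /good mderivM mevalM mevalD !mevalM derM // => -> ->.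
have goodX m : good 'X_[m].
  rewrite mpolyXE_id; apply: (big_ind good good1 goodM) => j _.
  elim: (m j) => [|n IHn]; rewrite ?expr0 // exprS; apply: (goodM) => //.
  by rewrite /good mevalXU krx mderiv_var; case: (i == j); rewrite ?meval1 ?meval0.
move=> Kp; rewrite [in LHS](mpolyE p) raddf_sum der_sum // /mderiv raddf_sum.
apply: eq_bigr => m _; rewrite /= !mevalZ derM // (proj2 (kerE _) (Kp m)) mul0r add0r.
by rewrite goodX mderivX mevalZ mulrA [p@_m * _]mulrC.
Qed.

Lemma delta_pow_meval alpha (p : {mpoly A[s]}) :
  algcoef p -> delta_pow delta alpha p.@[x] = p^`M[alpha].@[x].
Proof.
move=> Kp; rewrite /delta_pow /mderivm.
suff: algcoef (foldr (fun i => iter (alpha i) (mderiv i)) p (enum 'I_s)) /\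
    foldr (fun j b => iter (alpha j) (delta j) b) p.@[x] (enum 'I_s) =
    (foldr (fun i => iter (alpha i) (mderiv i)) p (enum 'I_s)).@[x] by case.
elim: (enum _) => //= i l [Kq ->].
elim: (alpha i) => //= n [Kqn ->]; split; first exact: algcoef_mderiv.
exact: der_meval.
Qed.

Lemma algcoef_mderivm alpha (p : {mpoly A[s]}) : algcoef p -> algcoef p^`M[alpha].
Proof. by move=> Kp m; rewrite mcoeff_mderivm; apply: alg_closureMn. Qed.

Lemma ffact_prod_gt0 (m m' : 'X_{1..s}) : (0 < \prod_(i < s) (m + m')%MM i ^_ m i)%N.
Proof. by rewrite prodn_gt0 // => i; rewrite ffact_gt0 mnmDE leq_addr. Qed.

(** Differentiating along the leading exponent [m] leaves only the leading coefficient times a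
    positive integer, since [m] has the largest degree in [p]; the same operator sends [p.@[x] = 0]
    to 0. *)
Lemma meval_eq0 (p : {mpoly A[s]}) : algcoef p -> p.@[x] = 0 -> p = 0.
Proof.
move=> Kp px; have [//|p0] := eqVneq p 0; set m := mlead p.
have pm : p^`M[m] = (p@_m *+ \prod_(i < s) (m + 0)%MM i ^_ m i)%:MP.
  apply/mpolyP => k; rewrite mcoeff_mderivm mcoeffC.
  have [->|k0] := eqVneq k 0%MM; first by rewrite mulr1 addm0.
  rewrite mulr0 memN_msupp_eq0 ?mul0rn //; apply: msize_mdeg_ge.
  by rewrite -mlead_deg // mdegD -addn1 leq_add2l lt0n mdeg_eq0.
have := delta_pow_meval m Kp; rewrite px pm mevalC.
have -> : delta_pow delta m 0 = 0.
  by rewrite /delta_pow; elim: (enum _) => //= i l ->; apply: iter_der0.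
case: (\prod_i _)%N (ffact_prod_gt0 m 0) => // n _ /esym /(natKI char0) /eqP.
by rewrite mleadc_eq0 (negPf p0).
Qed.

(** The constant coefficient of the derivative of [p] along [m] is [p@_m] times a positive integer,
    so vanishing of all derivatives of order above [i] bounds the degree by [i]. *)
Lemma filtration_meval i (p : {mpoly A[s]}) :
  algcoef p ->
  filtration delta i p.@[x] <-> forall m, (i < mdeg m)%N -> p@_m = 0.
Proof.
move=> Kp; split=> [Fp m lt_im|p_eq0 m lt_im].
  have pm : p^`M[m] = 0.
    by apply: meval_eq0; [apply: algcoef_mderivm | rewrite -delta_pow_meval // Fp].
  have := mcoeff_mderivm m p 0%MM; rewrite pm mcoeff0 addm0.
  have := ffact_prod_gt0 m 0%MM; rewrite addm0; case: (\prod_i _)%N => // n _.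
  by move/esym/(natKI char0).
rewrite delta_pow_meval // (_ : p^`M[m] = 0) ?meval0 //; apply/mpolyP => k.
by rewrite mcoeff_mderivm mcoeff0 p_eq0 ?mul0rn // mdegD ltn_addr.
Qed.

Hypotheses (comm : commuting delta) (nil : forall i, locally_nilpotent (delta i)).

(** Expansion in one variable at a time: the list [l] holds the indices whose derivations may still
    act nontrivially, and once it is empty the element is a constant. *)
Lemma meval_surj a : exists2 p : {mpoly A[s]}, algcoef p & p.@[x] = a.
Proof.
pose E b := exists2 p : {mpoly A[s]}, algcoef p & p.@[x] = b.
have ED b c : E b -> E c -> E (b + c).
  move=> [p Kp <-] [q Kq <-]; exists (p + q); first exact: algcoefD.
  by rewrite mevalD.
have EX i b : E b -> E (b * x i).
  move=> [p Kp <-]; exists (p * 'X_i); first exact/algcoefM/algcoefX.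
  by rewrite mevalM mevalXU.
have E0 : E 0.
  by exists 0; rewrite ?meval0 // => m; rewrite mcoeff0; apply: alg_closure0.
suff main (l : seq (ordinal s)) b : (forall j, j \notin l -> delta j b = 0) -> E b.
  by apply: (main (enum (ordinal s)) a) => j; rewrite mem_enum.
elim: l b => [|i l IHl] b kb.
  exists b%:MP; last by rewrite mevalC.
  by apply/algcoefC/kerE => i; apply: kb.
(* [S] is stable under [delta i] by commutation and under multiplication by [x i]; coefficients in
   [S] and in the kernel of [delta i] fall under the induction hypothesis for [l]. *)
pose S c := forall j, j \notin i :: l -> delta j c = 0.
have [n /eqP bn] := nil i b.
have dxi : delta i (x i) = 1 by rewrite krx eqxx.
have [|||||p pP <-] := dixmier_expansion char0 (der_delta i) dxi (S := S) _ _ _ _ _ kb bn.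
- by move=> j _; apply: der0.
- move=> u v Su Sv j jl.
  by rewrite -scaleN1r derD // derZ // Su // Sv // scaler0 addr0.
- by move=> k u Su j jl; rewrite derZ // Su // scaler0.
- by move=> u Su j jl; rewrite comm Su // der0.
- move=> u Su j jl; rewrite derM // Su // mulr0 addr0 krx.
  by move: jl; rewrite inE negb_or => /andP[/negPf-> _]; rewrite mul0r.
have : forall i, E p`_i.
  move=> k; apply: IHl => j jl; have [Spk dpk] := pP k.
  by have [->//|ji] := eqVneq j i; apply: Spk; rewrite inE negb_or ji.
elim/poly_ind: p {pP} => [|p c IHp] Ep; first by rewrite horner0.
rewrite hornerMXaddC; apply: ED.
  by apply/EX/IHp => k; have := Ep k.+1; rewrite coefD coefMX coefC addr0.
by have := Ep 0%N; rewrite coefD coefMX coefC add0r.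
Qed.

Lemma kronecker_polynomial_algebra : is_polynomial_algebra (alg_closure (A := A)) x.
Proof.
split; first exact: meval_surj.
move=> p q Kp Kq epq; apply/eqP; rewrite -subr_eq0; apply/eqP/meval_eq0.
  exact: algcoefB.
by rewrite mevalB epq subrr.
Qed.

Let phix := phi nil x.

Let dx i : delta i (x i) = 1. Proof. by rewrite krx eqxx. Qed.

Lemma phiD a b : phix (a + b) = phix a + phix b.
Proof.
rewrite /phix /phi; elim: (enum _) a b => //= i l IHl a b.
by rewrite phi1D // IHl.
Qed.

Lemma phiZ k a : phix (k *: a) = k *: phix a.
Proof.
rewrite /phix /phi; elim: (enum _) a => //= i l IHl a.
by rewrite phi1Z // IHl.
Qed.

Lemma phiM a b : phix (a * b) = phix a * phix b.
Proof.
rewrite /phix /phi; elim: (enum _) a b => //= i l IHl a b.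
by rewrite phi1M // IHl.
Qed.

Lemma phi_alg_closure a : alg_closure a -> phix a = a.
Proof.
move/kerE => ka; rewrite /phix /phi; elim: (enum _) => //= i l IHl.
by rewrite phi1_ker.
Qed.

Lemma phi0 : phix 0 = 0.
Proof. by apply/phi_alg_closure/alg_closure0. Qed.

(** The factors with index other than [j] fix [x j]; the factor of index [j] sends it to 0. *)
Lemma phi_var j : phix (x j) = 0.
Proof.
have phi_l0 l : foldl (fun b i => phi1 (nil i) (x i) b) 0 l = 0.
  by elim: l => //= i l IHl; rewrite phi1_ker // der0.
rewrite /phix /phi; have: j \in enum 'I_s by rewrite mem_enum.
elim: (enum _) => //= i l IHl; rewrite inE.
have [-> _|ij /= jl] := eqVneq j i; first by rewrite phi1_x.
by rewrite phi1_ker ?IHl // krx eq_sym (negPf ij).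
Qed.

Lemma phi_ideal a : ideal_gen x a -> phix a = 0.
Proof.
move=> [c ->]; rewrite (big_morph phix phiD phi0) big1 // => i _.
by rewrite phiM phi_var mulr0.
Qed.

(** [phi] kills the ideal of the variables, which contains [p.@[x] - p@_0], and fixes the constant
    [p@_0]. *)
Lemma phi_meval (p : {mpoly A[s]}) : algcoef p -> phix p.@[x] = p@_0.
Proof.
move=> Kp; rewrite -[p.@[x]](subrK p@_0) phiD phi_ideal ?add0r.
  exact: phi_alg_closure.
exact: meval_sub_const.
Qed.

Lemma phi_in_alg_closure a : alg_closure (phix a).
Proof. by have [p Kp <-] := meval_surj a; rewrite phi_meval. Qed.

Lemma phi_eq0 a : phix a = 0 <-> ideal_gen x a.
Proof.
split; last exact: phi_ideal.
have [p Kp <-] := meval_surj a; rewrite phi_meval // => p0.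
by have := meval_sub_const x p; rewrite p0 subr0.
Qed.

Lemma phi_evalK (r : nat) (y : 'I_r -> A) (f : {mpoly K[r]}) :
  evalK (fun j => phix (y j)) f = phix (evalK y f).
Proof.
have phi1_ : phix 1 = 1 by rewrite phi_alg_closure // -(scale1r 1); apply: alg_closure_alg.
rewrite /evalK /mmap (big_morph phix phiD phi0); apply: eq_bigr => m _.
rewrite !mulr_algl phiZ; congr (_ *: _); rewrite /mmap1 (big_morph phix phiM phi1_).
by apply: eq_bigr => i _; elim: (m i) => [|n IHn]; rewrite ?expr0 // !exprS phiM IHn.
Qed.

End KroneckerPolynomial.

(** * Dimension of the filtration *)

(** Exponents of degree at most [i] correspond to [s]-tuples over ['I_i.+1] with sum at most [i],
    whose number is known. *)
Lemma card_bmultinom (s i : nat) : #|{: 'X_{1..s < i.+1}}| = 'C(i + s, s).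
Proof.
rewrite addnC -card_partial_ord_partitions.
pose f (m : 'X_{1..s < i.+1}) : s.-tuple 'I_i.+1 := [tuple inord (m k) | k < s].
have le_i (m : 'X_{1..s < i.+1}) k : (m k <= i)%N.
  rewrite -ltnS; apply: leq_trans (bmdeg m); rewrite ltnS mdegE (bigD1 k) //=.
  exact: leq_addr.
have inj_f : injective f.
  move=> m m' e; apply/val_inj/mnmP => k.
  have := congr1 (fun t : s.-tuple 'I_i.+1 => val (tnth t k)) e.
  by rewrite /f !tnth_mktuple /= !inordK ?ltnS.
rewrite -cardsT -(card_imset _ inj_f); apply: eq_card => t; rewrite !inE big_tuple.
apply/imsetP/idP => [[m _ ->]|le_ti].
  have := bmdeg m; rewrite ltnS mdegE; congr (_ <= _)%N; apply: eq_bigr => k _.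
  by rewrite tnth_mktuple inordK ?ltnS.
have lt_m : (mdeg [multinom (tnth t k : nat) | k < s] < i.+1)%N.
  by rewrite ltnS mdegE; move: le_ti; congr (_ <= _)%N; apply: eq_bigr => k _; rewrite mnmE.
exists (BMultinom lt_m) => //; apply: eq_from_tnth => k.
by rewrite tnth_mktuple /= mnmE inord_val.
Qed.

Lemma has_dim_fin (K : fieldType) (V : lmodType K) (S : V -> Prop) (T : finType) (b : T -> V) :
  (forall t, S (b t)) ->
  (forall c : T -> K, \sum_t c t *: b t = 0 -> forall t, c t = 0) ->
  (forall v, S v -> exists c : T -> K, v = \sum_t c t *: b t) ->
  has_dim S #|T|.
Proof.
move=> Sb indb genb; exists (fun i => b (enum_val i)); split=> [//|c sum0 i|v /genb[c ->]].
  rewrite -[i]enum_valK; apply: (indb (fun t => c (enum_rank t))).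
  rewrite -[RHS]sum0 (reindex _ (onW_bij _ (@enum_val_bij T))).
  by apply: eq_bigr => j _; rewrite enum_valK.
exists (fun i => c (enum_val i)).
by rewrite (reindex _ (onW_bij _ (@enum_val_bij T))).
Qed.

(** A basis consists of the products of a [K]-basis of the algebraic elements with the monomials of
    degree at most [i] in the [x j]. *)
Lemma filtration_dim (K : fieldType) (A : comAlgType K) (s d : nat)
    (delta : 'I_s -> A -> A) (x : 'I_s -> A) :
  [pchar K] =i pred0 -> (forall i, is_derivation (delta i)) -> commuting delta ->
  (forall i, locally_nilpotent (delta i)) -> kronecker delta x ->
  (forall b, kernel delta b <-> alg_closure b) ->
  has_dim (alg_closure (A := A)) d ->
  forall i, has_dim (filtration delta i) (d * 'C(i + s, s))%N.
Proof.
move=> char0 der_delta comm nil krx kerE [e [Ke inde gene]] i.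
rewrite -card_bmultinom -{1}(card_ord d) -card_prod.
pose mon (m : 'X_{1..s}) := ('X_[m] : {mpoly A[s]}).@[x].
(* A [K]-combination is regrouped as the value of one polynomial. Its coefficients are given by a
   function on all exponents, 0 beyond degree [i], the form in which [mcoeff_mpoly] reads them
   back. *)
have sumE (c : 'I_d * 'X_{1..s < i.+1} -> K) :
    \sum_u c u *: (e u.1 * mon u.2) =
    (\sum_(m : 'X_{1..s < i.+1})
       (\sum_j (if insub (m : 'X_{1..s}) is Some m' then c (j, m') else 0) *: e j)
         *: 'X_[m]).@[x].
  transitivity (\sum_j \sum_m c (j, m) *: (e j * mon m)).
    by rewrite pair_bigA; apply: eq_bigr => -[].
  rewrite exchange_big raddf_sum.
  apply: eq_bigr => m _; rewrite /= mevalZ mulr_suml; apply: eq_bigr => j _.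
  by rewrite valK scalerAl.
apply: (has_dim_fin (b := fun u : 'I_d * 'X_{1..s < i.+1} => e u.1 * mon u.2)).
- move=> [j m] /=; rewrite -mevalZ; apply/filtration_meval => //.
    by apply: algcoefZ => //; apply: algcoefX.
  move=> k lt_ik; rewrite mcoeffZ mcoeffX; case: eqP => [e_mk|]; last by rewrite mulr0.
  by have := bmdeg m; rewrite e_mk ltnS leqNgt lt_ik.
- move=> c; rewrite sumE => sum0 [j m].
  pose F (k : 'X_{1..s}) :=
    \sum_j (if insub k is Some m' then c (j, m' : 'X_{1..s < i.+1}) else 0) *: e j.
  have Fm : F m = 0.
    rewrite -(mcoeff_mpoly F (bmdeg m)) (meval_eq0 char0 der_delta kerE krx _ sum0) ?mcoeff0 //.
    apply: algcoef_sum => k; apply: algcoefZ; last exact: algcoefX.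
    by apply: alg_closure_sum => j'; apply: alg_closureZ.
  have := inde (fun j => c (j, m)); apply; rewrite -[RHS]Fm /F valK.
  by [].
move=> v Fv.
have [p Kp pv] := meval_surj char0 der_delta kerE krx comm nil v.
have /boolp.choice[c cE] : forall m : 'X_{1..s < i.+1}, exists c : 'I_d -> K,
    p@_m = \sum_j c j *: e j.
  by move=> m; apply: gene.
exists (fun u => c u.2 u.1); rewrite sumE -pv; congr (_.@[x]).
have szp : (msize p <= i.+1)%N.
  move: Fv; rewrite -pv => /(filtration_meval char0 der_delta kerE krx _ Kp) Fp.
  rewrite msizeE; apply/bigmax_leqP_seq => m mp _; rewrite leqNgt ltnS.
  apply: contraL mp => lt_im; rewrite -mcoeff_eq0; apply/eqP; exact: Fp.
rewrite [LHS](mpolywE szp); apply: eq_bigr => m _; congr (_ *: _).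
by rewrite cE; apply: eq_bigr => j _; rewrite valK.
Qed.

(** [s!] times the binomial is [(i + 1) ... (i + s)], the value at [i] of the monic polynomial [P]
    of degree [s] with roots [-1, ..., -s]; [q] is the scaled difference of [P] and ['X^s]. *)
Lemma hilbert_polynomial (d s : nat) :
  exists2 q : {poly rat}, (size q <= s)%N &
    forall i : nat, (d * 'C(i + s, s))%N%:R
      = d%:R / s`!%:R * i%:R ^+ s + q.[i%:R].
Proof.
pose P : {poly rat} := \prod_(j < s) ('X - (- j.+1%:R)%:P).
have szP : size P = s.+1 by rewrite size_prod_XsubC [index_enum _]unlock -enumT size_enum_ord.
have monP : P \is monic by apply: monic_prod_XsubC.
exists ((d%:R / s`!%:R) *: (P - 'X^s)).
  apply: leq_trans (size_scale_leq _ _) _; apply/leq_sizeP => k.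
  rewrite leq_eqVlt => /orP[/eqP<-|lt_sk]; rewrite coefB coefXn.
    by have := monicP monP; rewrite lead_coefE szP /= => ->; rewrite eqxx subrr.
  by rewrite nth_default ?szP // gtn_eqF // subrr.
move=> i; rewrite hornerZ hornerD hornerN hornerXn -mulrDr addrCA subrr addr0.
have fact0 : s`!%:R != 0 :> rat by rewrite Num.Theory.pnatr_eq0 -lt0n fact_gt0.
apply: (mulIf fact0); rewrite mulrAC divfK // natrM -mulrA; congr (_ * _).
rewrite -natrM bin_ffact horner_prod ffact_prod natr_prod.
rewrite (reindex_inj rev_ord_inj); apply: eq_bigr => j _.
rewrite hornerXsubC opprK -natrD /= -addnBA ?leq_subr //; congr (_%:R).
by rewrite subKn.
Qed.

(** * Partial derivatives on a polynomial algebra *)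

Section PartialDerivatives.
Variables (K : fieldType) (A : comAlgType K) (s : nat) (x : 'I_s -> A).
Hypothesis polyA : is_polynomial_algebra (alg_closure (A := A)) x.

Lemma partial_derivatives : exists delta : 'I_s -> A -> A,
  [/\ (forall i, is_derivation_over (alg_closure (A := A)) (delta i)), commuting delta,
      (forall i, locally_nilpotent (delta i)) & kronecker delta x].
Proof.
have [surj uniq_] := polyA.
(* [P a] is the polynomial representing [a]; uniqueness makes [P] additive and multiplicative, so
   formal partial derivatives carry over to [A]. *)
have /boolp.choice[P PP] : forall a, exists p : {mpoly A[s]}, algcoef p /\ p.@[x] = a.
  by move=> a; have [p Kp pa] := surj a; exists p.
have PE (p : {mpoly A[s]}) a : algcoef p -> p.@[x] = a -> P a = p.
  by move=> Kp pa; have [KP Pa] := PP a; apply: uniq_ => //; rewrite Pa.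
have KP a : algcoef (P a) by have [] := PP a.
have PK a : (P a).@[x] = a by have [] := PP a.
have PD a b : P (a + b) = P a + P b.
  by apply: PE; [apply: algcoefD | rewrite mevalD !PK].
have PM a b : P (a * b) = P a * P b.
  by apply: PE; [apply: algcoefM | rewrite mevalM !PK].
have PC c : alg_closure c -> P c = c%:MP.
  by move=> Kc; apply: PE; [apply: algcoefC | rewrite mevalC].
have PX i : P (x i) = 'X_i by apply: PE; [apply: algcoefX | rewrite mevalXU].
pose delta i a := (P a)^`M(i).@[x].
have Pdelta i a : P (delta i a) = (P a)^`M(i) by apply: PE => //; apply: algcoef_mderiv.
have deltaM i a b : delta i (a * b) = delta i a * b + a * delta i b.
  by rewrite /delta PM mderivM mevalD !mevalM !PK.
have deltaC i c : alg_closure c -> delta i c = 0.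
  by move=> Kc; rewrite /delta PC // mderivC meval0.
have deltaCM i c a : alg_closure c -> delta i (c * a) = c * delta i a.
  by move=> Kc; rewrite deltaM deltaC // mul0r add0r.
exists delta; split.
- move=> i; split; last by move=> c a; apply: deltaCM.
  split=> // k u v; rewrite -mulr_algl /delta PD mderivD mevalD.
  by rewrite -!/(delta i _) deltaCM ?mulr_algl //; apply: alg_closure_alg.
- by move=> i j a; rewrite /delta !Pdelta mderiv_comm.
(* [msize] exceeds the degree, so that many derivatives annihilate the polynomial. *)
- move=> i a; exists (msize (P a)); set n := msize _.
  have Pn : P (iter n (delta i) a) = (P a)^`M(i, n).
    rewrite mderivn_iter; elim: n => //= n IHn; by rewrite Pdelta IHn.
  rewrite -[iter _ _ _]PK Pn (_ : _^`M(i, n) = 0) ?meval0 //; apply/mpolyP => m.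
  rewrite mcoeff_mderivm mcoeff0 memN_msupp_eq0 ?mul0rn //; apply: msize_mdeg_ge.
  by rewrite mdegD mdegMn mdeg1 mul1n leq_addr.
- by move=> i j; rewrite /delta PX mderiv_var; case: (i == j); rewrite ?meval1 ?meval0.
Qed.

End PartialDerivatives.

(** [x i] is killed by every [delta j] with [j != i], but not by [delta i]. *)
Lemma kronecker_generic_kernels (K : fieldType) (A : comAlgType K) (s : nat)
    (delta : 'I_s -> A -> A) (x : 'I_s -> A) :
  kronecker delta x -> generic_kernels delta.
Proof.
move=> krx i kerE; have /eqP := krx i i; rewrite eqxx.
have -> : delta i (x i) = 0.
  by apply/(proj2 (kerE (x i))) => j ji; rewrite krx (negPf ji).
by rewrite eq_sym oner_eq0.
Qed.

(** * The equivalences, and the field of algebraic elements as image of [phi] *)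

Theorem corollary5p3 (K : fieldType) (A : comAlgType K) (r s : nat)
    (y : 'I_r -> A)
    (char0 : [pchar K] =i pred0)
    (domA : GRing.integral_domain_axiom A)
    (genA : generates y)
    (s_ge1 : (1 <= s)%N)
    (dimA : krull_dim_is A s) :
  let Kt := alg_closure (A := A) in
  let stmt1 :=
    exists delta : 'I_s -> A -> A,
      [/\ (forall i, is_derivation (delta i)), commuting delta,
          (forall i, locally_nilpotent (delta i)) & generic_kernels delta] in
  let stmt2 := exists x : 'I_s -> A, is_polynomial_algebra Kt x in
  let stmt3 :=
    exists (delta : 'I_s -> A -> A) (x : 'I_s -> A),
      [/\ (forall i, is_derivation_over Kt (delta i)), commuting delta,
          (forall i, locally_nilpotent (delta i)) & kronecker delta x] in
  (is_subfield Kt /\ forall c : K, Kt c%:A) /\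
  exists d : nat,
    [/\ has_dim Kt d,
        (stmt1 <-> stmt2), (stmt2 <-> stmt3)
      & forall (delta : 'I_s -> A -> A) (x : 'I_s -> A)
          (nil_delta : forall i, locally_nilpotent (delta i)),
        (forall i, is_derivation (delta i)) ->
        commuting delta ->
        generic_kernels delta ->
        kronecker delta x ->
        let phix := phi nil_delta x in
        [/\ (* (i) *)
            (forall i, has_dim (filtration delta i) (d * 'C(i + s, s))%N) /\
            (exists2 q : {poly rat}, (size q <= s)%N &
               forall i : nat, (d * 'C(i + s, s))%N%:R
                 = d%:R / s`!%:R * i%:R ^+ s + q.[i%:R]),
            (* (ii) *)
            [/\ linear phix, GRing.monoid_morphism phix,
                (forall c, Kt c <-> exists a, phix a = c)
              & (forall a, phix a = 0 <-> ideal_gen x a)]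
          & (* (ii), alternative description of Kt *)
            (forall c, Kt c <->
               exists f : {mpoly K[r]}, evalK (fun j => phix (y j)) f = c) /\
            (forall f : {mpoly K[r]},
               evalK (fun j => phix (y j)) f = 0 <->
               ideal_gen x (evalK (fun j => phix (y j)) f))]].
Proof.
move=> Kt stmt1 stmt2 stmt3.
split; first by split; [apply: alg_closure_subfield | apply: alg_closure_alg].
have kronecker_ker delta (x : 'I_s -> A) : (forall i, is_derivation (delta i)) ->
    kronecker delta x -> forall b, kernel delta b <-> Kt b.
  by move=> der krx; apply: (kronecker_kernel char0 domA der genA dimA krx).
have stmt12 : stmt1 -> stmt2.
  move=> [delta [der comm nil gen]].
  have [x krx] := generic_kernels_kronecker char0 domA der genA dimA comm nil gen.
  exists x; apply: (kronecker_polynomial_algebra char0 der _ krx comm nil).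
  exact: kronecker_ker krx.
have stmt23 : stmt2 -> stmt3.
  move=> [x polyA]; have [delta deltaP] := partial_derivatives polyA.
  by exists delta, x.
have stmt31 : stmt3 -> stmt1.
  move=> [delta [x [der comm nil krx]]]; exists delta; split=> //.
    by move=> i; have [] := der i.
  exact: kronecker_generic_kernels krx.
have [d Ktd] := alg_closure_fin_dim domA genA.
exists d; split=> //; [by split=> // /stmt23 | by split=> // /stmt31 |].
move=> delta x nil der comm _ krx phix.
have kerE := kronecker_ker delta x der krx.
have phi_ranP c : Kt c <-> exists a, phix a = c.
  split=> [Kc|[a <-]]; last exact: (phi_in_alg_closure char0 der kerE krx comm).
  by exists c; apply: (phi_alg_closure char0 der kerE krx).
split.
- split; first exact: filtration_dim krx kerE Ktd.
  exact: hilbert_polynomial.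
- split=> //.
  + by move=> k a b; rewrite /phix phiD // phiZ.
  + split; last by move=> a b; apply: phiM.
    by rewrite /phix phi_alg_closure //; have [] := alg_closure_subfield domA.
  + by move=> a; apply: phi_eq0.
split=> [c|f].
  rewrite phi_ranP; split=> [[a <-]|[f <-]].
    have [f <-] := genA a; exists f.
    exact: (phi_evalK char0 der kerE krx).
  exists (evalK y f); rewrite (phi_evalK char0 der kerE krx).
  by [].
(* Membership of [phi(a)] in the ideal means [phi(phi(a)) = 0], and [phi] fixes its own values
   because they are algebraic over [K]. *)
rewrite (phi_evalK char0 der kerE krx); rewrite -/phix.
rewrite -(phi_eq0 char0 der kerE krx comm nil) -/phix.
by rewrite [phix (phix _)]phi_alg_closure //; apply: phi_in_alg_closure.
Qed.
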